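(* For every integer $k$ with $1\le k\le 50{,}000{,}000$, the following two conditions are equivalent: (i) for every integer $n>1$ the open interval $(kn,(k+1)n)$ contains a prime; (ii) $k\in\{1,2,3,5,9,14\}$. *)

(* Defs.v *)
From Stdlib Require Export ZArith Znumtheory List.

(* Main.v *)
(** A prime in (14n, 15n) for every n > 1 settles the six listed multipliers: for
    k < 14 and n large, (kn, (k+1)n) contains some (14m, 15m).  For large n such a prime
    comes from explicit bounds 0.96775 z - C <= psi(z) <= 1.03131 z + C.  Since
    ln(y!) = sum_k Lambda(k) floor(y/k), one has
      ln(y!) - m ln(floor(y/m)!) = sum_k Lambda(k) (floor(y/k) mod m) = y ln m + O(m ln y),
    so an inequality sum_m a_m (j mod m) <= sum_(i <= j) w_i holding for all j >= 1 turns
    into y sum_m a_m ln m - O(ln y) <= sum_i w_i psi(y/i), and known bounds for the terms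
    with i > 1 give a new bound for psi(y).  One step with Chebyshev's weights and two
    steps with weights found by linear programming suffice.

    For any other k one looks for n such that every kn + i with 0 < i < n has a prime
    factor up to 503.  This depends only on residues of k.  A search over the residues
    modulo 2, 3, 5, 7, 11, 13 leaves 1166 classes r modulo 30030; in each of them,
    k = r + 30030 t is sieved over t by the primes from 17 to 503, first with the n for
    which a single kn + i has no known factor, then with the remaining n.  The 188 numbers
    k > 503 that survive are listed with an n and the larger prime factors needed. *)

Require Import Defs.
From Stdlib Require Import Lia MSetPositive Reals Lra.
From mathcomp Require ssreflect ssrfun ssrbool eqtype ssrnat seq div choice fintype bigop prime.
From Stdlib Require Import ZArith Znumtheory List.
Import ListNotations.
Open Scope Z_scope.

(** * Multipliers with a prime-free interval *)

(* Unlike [forallb] and [existsb], these stop early under call-by-value evaluation. *)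
Definition all {A} (f : A -> bool) := fix all (l : list A) : bool :=
  match l with [] => true | x :: l => if f x then all l else false end.
Definition ex {A} (f : A -> bool) := fix ex (l : list A) : bool :=
  match l with [] => false | x :: l => if f x then true else ex l end.

Lemma all_spec {A} (f : A -> bool) l : all f l = true -> forall x, In x l -> f x = true.
Proof.
  induction l as [|y l IH]; simpl; [easy|].
  destruct (f y) eqn:fy; [|easy]. intros H x [<-|]; auto.
Qed.

Lemma ex_spec {A} (f : A -> bool) l : ex f l = true -> exists x, In x l /\ f x = true.
Proof.
  induction l as [|y l IH]; simpl; [easy|].
  destruct (f y) eqn:fy; [exists y; auto|].
  intros H. destruct (IH H) as [x [? ?]]. exists x; auto.
Qed.

Definition zrange (n : Z) : list Z := map Z.of_nat (seq 1 (Z.to_nat n)).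

Lemma in_zrange n i : 1 <= i <= n -> In i (zrange n).
Proof.
  intros H. unfold zrange. apply in_map_iff. exists (Z.to_nat i). split; [lia|].
  apply in_seq. lia.
Qed.

(* For a modulus [(p, u)], residue lists store [u * k] modulo [p], normalised to [1 .. p].
   A form [k n + i] is represented by the list of its roots in these coordinates, [0]
   standing for "no root"; a group collects, for one [n], the forms without known factor. *)
Definition modulus : Type := (Z * Z)%type.

(** * Arithmetic of residue lists *)

Definition reduce (p x : Z) : Z := let y := x mod p in if y =? 0 then p else y.
Definition add_mod (p a b : Z) : Z := let s := a + b in if s <=? p then s else s - p.
(** The mark [0] for a missing root is kept, and entries in [[1 .. p]] never produce it: equal
    entries give [p]. *)
Definition sub_mod (p a b : Z) : Z :=
  match a with Z0 => Z0 | _ => let d := a - b in match d with Zpos _ => d | _ => d + p end end.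

Fixpoint map2 (f : Z -> Z -> Z -> Z) (ms : list modulus) (a b : list Z) : list Z :=
  match ms, a, b with
  | (p, _) :: ms, x :: a, y :: b => f p x y :: map2 f ms a b
  | _, _, _ => []
  end.

Lemma add_mod_spec p a b : (p | a + b - add_mod p a b).
Proof.
  unfold add_mod. destruct (a + b <=? p); [exists 0|exists 1]; lia.
Qed.

Lemma sub_mod_spec p a b : sub_mod p a b <> 0 -> a <> 0 /\ (p | sub_mod p a b - (a - b)).
Proof.
  unfold sub_mod. intros H. split; [destruct a; congruence|].
  assert (E : match a - b with Zpos _ => a - b | _ => a - b + p end = a - b \/
              match a - b with Zpos _ => a - b | _ => a - b + p end = a - b + p)
    by (destruct (a - b); auto).
  destruct a; [congruence| |]; destruct E as [-> | ->]; (exists 0; lia) || (exists 1; lia).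
Qed.

Definition residues (ms : list modulus) (row : list Z) (x : Z) : Prop :=
  Forall2 (fun m y => (fst m | snd m * x - y)) ms row.

Lemma residues_add ms a b x y : residues ms a x -> residues ms b y ->
  residues ms (map2 add_mod ms a b) (x + y).
Proof.
  intros Ha; revert b; induction Ha as [|[p u] c ms a H Ha IH]; intros b Hb; inversion Hb; subst.
  - constructor.
  - simpl in *. constructor; [|now apply IH]. simpl.
    replace (u * (x + y) - add_mod p c y0)
      with ((u * x - c) + (u * y - y0) + (c + y0 - add_mod p c y0)) by ring.
    apply Z.divide_add_r; [now apply Z.divide_add_r|apply add_mod_spec].
Qed.

(** * Forms [k n + i] and their known factors *)

Definition has_factor (ps : list Z) (x : Z) : Prop := exists p, In p ps /\ (p | x).
Definition covered (ps : list Z) (k : Z) : Prop :=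
  exists n, 1 < n /\ forall i, 0 < i < n -> has_factor ps (k * n + i).

Definition form_ok (k : Z) (ms : list modulus) (n i : Z) (f : list Z) : Prop :=
  Forall2 (fun m x => x <> 0 -> (fst m | snd m * k - x) -> (fst m | k * n + i)) ms f.

(** Only forms not yet known to have a factor are kept, so that an empty group certifies its
    multiplier [n]. *)
Definition group_ok (ps : list Z) (k : Z) (ms : list modulus) (g : list (list Z)) : Prop :=
  exists n, 1 < n /\ forall i, 0 < i < n ->
    has_factor ps (k * n + i) \/ exists f, In f g /\ form_ok k ms n i f.

Lemma group_ok_nil ps k ms : group_ok ps k ms [] -> covered ps k.
Proof.
  intros [n [n1 H]]. exists n; split; auto.
  intros i Hi. destruct (H i Hi) as [|[f [[] _]]]; auto.
Qed.

Lemma residues_mul (ms : list modulus) x : Forall (fun m => 1 <= fst m) ms ->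
  residues ms (map (fun m => snd m * x mod fst m) ms) x.
Proof.
  induction 1 as [|[p u] ms Hp Hms IH]; [constructor|]. constructor; [|exact IH].
  cbn [fst snd] in *. exists (u * x / p). rewrite (Z.div_mod (u * x) p) at 1 by lia. ring.
Qed.

Definition restrict (x : Z) (g : list (list Z)) : list (list Z) :=
  flat_map (fun f => match f with
    | [] => []
    | y :: f => if y =? 0 then [f] else if y =? x then [] else [f]
    end) g.

(** Fixing the coordinate of [k] modulo [p] either exhibits the factor [p] of a form, whose root is
    then [x], or rules [p] out and consumes this coordinate. *)
Lemma restrict_ok ps k p u ms x g : In p ps -> (p | u * k - x) ->
  group_ok ps k ((p, u) :: ms) g -> group_ok ps k ms (restrict x g).
Proof.
  intros Hp Hx [n [n1 H]]. exists n; split; auto.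
  intros i Hi. destruct (H i Hi) as [|[f [Hf Of]]]; [now left|].
  inversion Of as [|m y ms' f' Hy Of' E1 E2]; subst. simpl in Hy.
  destruct (Z.eq_dec y 0) as [y0|y0].
  - right; exists f'; split; auto. apply in_flat_map. exists (y :: f'); split; auto.
    now rewrite (proj2 (Z.eqb_eq _ _) y0); left.
  - destruct (Z.eq_dec y x) as [->|yx].
    + left. exists p; auto.
    + right; exists f'; split; auto. apply in_flat_map. exists (y :: f'); split; auto.
      rewrite (proj2 (Z.eqb_neq _ _) y0), (proj2 (Z.eqb_neq _ _) yx). now left.
Qed.

Fixpoint meets (f row : list Z) : bool :=
  match f, row with
  | s :: f, x :: row =>
    if match s with Z0 => false | _ => s =? x end then true else meets f row
  | _, _ => false
  end.

(** As [u * M0] is [1] modulo [p], the coordinate [u * k] is congruent to [u * r + t], and a root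
    [x] for [k] becomes the root [x - u * r] for [t]. This is the reason for the factor [u]: one
    table of residues of [t] serves every class [r]. *)
Lemma meets_ok ps k ms M0 r t n i f rho row :
  incl (map fst ms) ps -> Forall (fun m => (fst m | snd m * M0 - 1)) ms -> k = r + M0 * t ->
  form_ok k ms n i f -> residues ms rho r -> residues (map (fun m => (fst m, 1)) ms) row t ->
  meets (map2 sub_mod ms f rho) row = true -> has_factor ps (k * n + i).
Proof.
  intros Hps Hu Hk Hf; revert rho row.
  induction Hf as [|[p u] x ms f Hx Hf IH]; intros rho row Hrho Hrow; [easy|].
  inversion Hrho as [|? a ? rho' Ha Hrho' E1 E2]; subst.
  inversion Hrow as [|? b ? row' Hb Hrow' E1 E2]; subst.
  inversion Hu as [|? ? Hu1 Hu2 E1]; subst. simpl in *.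
  assert (IH' := IH (fun q Hq => Hps q (or_intror Hq)) Hu2 rho' row' Hrho' Hrow').
  destruct (Z.eq_dec (sub_mod p x a) 0) as [e|ne].
  { now rewrite e. }
  destruct (Z.eq_dec (sub_mod p x a) b) as [e|nb].
  - intros _. destruct (sub_mod_spec p x a ne) as [x0 Hs]. exists p; split; [apply Hps; now left|].
    apply Hx; auto. rewrite e in Hs.
    replace (u * (r + M0 * t) - x)
      with ((u * r - a) + (u * M0 - 1) * t + (1 * t - b) + (b - (x - a))) by ring.
    apply Z.divide_add_r; auto. apply Z.divide_add_r; auto.
    apply Z.divide_add_r; auto. now apply Z.divide_mul_l.
  - destruct (sub_mod p x a) eqn:E; [easy| |]; rewrite (proj2 (Z.eqb_neq _ _) nb); auto.
Qed.

(** * Sieving over [t] *)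

Definition mem (x : Z) (s : PositiveSet.t) : bool :=
  match x with Zpos q => PositiveSet.mem q s | _ => false end.
Fixpoint mark (f : list Z) (ks : list PositiveSet.t) : list PositiveSet.t :=
  match f, ks with
  | x :: f, s :: ks => match x with Zpos q => PositiveSet.add q s | _ => s end :: mark f ks
  | _, _ => []
  end.
Fixpoint marked (ks : list PositiveSet.t) (row : list Z) : bool :=
  match ks, row with
  | s :: ks, x :: row => if mem x s then true else marked ks row
  | _, _ => false
  end.

Lemma mem_add x y s :
  mem y (match x with Zpos q => PositiveSet.add q s | _ => s end) = true ->
  mem y s = true \/ match x with Z0 => false | _ => x =? y end = true.
Proof.
  destruct x as [|q|q]; [auto| |auto]. destruct y as [|z|z]; try discriminate. simpl. intros H.
  apply PositiveSet.mem_spec, PositiveSet.add_spec in H. destruct H as [->|H].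
  - right. apply Pos.eqb_refl.
  - left. now apply PositiveSet.mem_spec.
Qed.

Lemma marked_mark f ks row : marked (mark f ks) row = true ->
  meets f row = true \/ marked ks row = true.
Proof.
  revert ks row; induction f as [|x f IH]; intros [|s ks] [|y row]; try easy.
  cbn [mark marked meets]. intros H.
  destruct (mem y (match x with Zpos q => _ | _ => s end)) eqn:Hm.
  - destruct (mem_add _ _ _ Hm) as [-> | ->]; auto.
  - destruct (IH _ _ H) as [-> | ->]; [left|right].
    + destruct x; auto; destruct (_ =? _); auto.
    + now destruct (mem y s).
Qed.

(** One set per modulus unites the roots of all the forms, so that a row needs one lookup per
    modulus instead of one per form and modulus. *)
Definition marks (n : nat) (fs : list (list Z)) : list PositiveSet.t :=
  fold_right mark (repeat PositiveSet.empty n) fs.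

Lemma marked_marks n fs row : marked (marks n fs) row = true ->
  exists f, In f fs /\ meets f row = true.
Proof.
  induction fs as [|f fs IH]; simpl.
  - revert row; induction n as [|n IH]; intros [|x row]; simpl; try easy.
    intros H. destruct (IH row) as [f [[] _]]. now destruct x.
  - intros H. destruct (marked_mark _ _ _ H) as [H'|H']; [exists f; auto|].
    destruct (IH H') as [g [? ?]]. exists g; auto.
Qed.

(* The residue rows of [t = 0, 1, ..], grouped by their first few entries. *)
Inductive rows : Type :=
  | Rows (l : list (Z * list Z))
  | Split (l : list (Z * rows)).

(** Here [ks] has already lost the sets of the first [d] moduli. A hit at a [Split] disposes of all
    rows below it at once. *)
Fixpoint sieve (fb : Z -> list Z -> bool) (ks : list PositiveSet.t) (d : nat) (T : rows)
    {struct T} : bool :=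
  match T with
  | Rows l => all (fun tr => if marked ks (skipn d (snd tr)) then true else fb (fst tr) (snd tr)) l
  | Split l =>
    match ks with
    | [] => false
    | s :: ks => all (fun xT => if mem (fst xT) s then true else sieve fb ks (S d) (snd xT)) l
    end
  end.

Fixpoint in_rows (t : Z) (row : list Z) (d c : nat) (T : rows) : Prop :=
  match c, T with
  | O, Rows l => In (t, row) l
  | S c, Split l => exists T', In (nth d row 0, T') l /\ in_rows t row (S d) c T'
  | _, _ => False
  end.

Lemma sieve_ok fb t row c : forall ks d T, in_rows t row d c T -> sieve fb ks d T = true ->
  marked ks (skipn d row) = true \/ fb t row = true.
Proof.
  induction c as [|c IH]; intros ks d [l|l] HT; simpl in HT; try easy.
  - intros H. assert (H' := all_spec (fun tr => if marked ks (skipn d (snd tr)) then true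
      else fb (fst tr) (snd tr)) l H _ HT). simpl in H'. clear H.
    destruct (marked ks (skipn d row)); auto.
  - destruct HT as [T' [Hin HT']]. destruct ks as [|s ks]; [easy|]. intros H.
    assert (H' := all_spec (fun xT => if mem (fst xT) s then true
      else sieve fb ks (S d) (snd xT)) l H _ Hin). simpl in H'. clear H.
    (* A row may be shorter than [d]; then [nth] returns [0], which belongs to no marked set. *)
    assert (E : skipn d row = [] /\ skipn (S d) row = [] /\ nth d row 0 = 0 \/
                skipn d row = nth d row 0 :: skipn (S d) row).
    { clear. revert row; induction d as [|d IH]; intros [|x row]; simpl; auto. }
    destruct E as [[E1 [E2 E3]]|E].
    + rewrite E3 in H'. simpl in H'. destruct (IH _ _ _ HT' H') as [H|H]; auto.
      rewrite E2 in H. destruct ks; simpl in H; easy.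
    + rewrite E. simpl. destruct (mem (nth d row 0) s); auto.
      exact (IH _ _ _ HT' H').
Qed.

Fixpoint split_rows (c d : nat) (ms : list modulus) (l : list (Z * list Z)) : rows :=
  match c with
  | O => Rows l
  | S c => Split (map (fun x =>
      (x, split_rows c (S d) ms (filter (fun tr => nth d (snd tr) 0 =? x) l)))
      (zrange (fst (nth d ms (0, 0)))))
  end.

Definition normal (ms : list modulus) (row : list Z) : Prop :=
  Forall2 (fun m x => 1 <= x <= fst m) ms row.

Lemma normal_nth ms row d : normal ms row -> (d < length ms)%nat ->
  1 <= nth d row 0 <= fst (nth d ms (0, 0)).
Proof.
  intros H; revert d; induction H; intros [|d]; simpl; intros; try lia.
  apply IHForall2; lia.
Qed.

Lemma in_split_rows ms t row c : forall d l, (d + c <= length ms)%nat -> normal ms row ->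
  In (t, row) l -> in_rows t row d c (split_rows c d ms l).
Proof.
  induction c as [|c IH]; simpl; intros d l Hd Hn Hin; auto.
  exists (split_rows c (S d) ms (filter (fun tr => nth d (snd tr) 0 =? nth d row 0) l)). split.
  - apply in_map_iff. exists (nth d row 0). split; auto.
    apply in_zrange, normal_nth; auto; lia.
  - apply IH; auto; [lia|]. apply filter_In; split; auto. apply Z.eqb_refl.
Qed.

Fixpoint next_row (ms : list modulus) (row : list Z) : list Z :=
  match ms, row with
  | (p, _) :: ms, x :: row => (if x =? p then 1 else x + 1) :: next_row ms row
  | _, _ => []
  end.

Fixpoint make_rows (n : nat) (ms : list modulus) (t : Z) (row : list Z) : list (Z * list Z) :=
  match n with
  | O => []
  | S n => (t, row) :: make_rows n ms (t + 1) (next_row ms row)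
  end.

Lemma in_make_rows n ms : forall t0 row0, Forall (fun m => 1 <= fst m) ms ->
  normal ms row0 -> residues (map (fun m => (fst m, 1)) ms) row0 t0 ->
  forall t, t0 <= t < t0 + Z.of_nat n -> exists row, In (t, row) (make_rows n ms t0 row0) /\
    normal ms row /\ residues (map (fun m => (fst m, 1)) ms) row t.
Proof.
  induction n as [|n IH]; intros t0 row0 Hp Hn Hr t Ht; [lia|].
  simpl. destruct (Z.eq_dec t t0) as [->|ne]; [exists row0; auto|].
  destruct (IH (t0 + 1) (next_row ms row0)) with (t := t) as [row [? ?]]; auto; try lia.
  - clear - Hp Hn. induction Hn as [|[p u] x ms row H Hn IHn]; simpl; constructor; simpl in *.
    + destruct (Z.eqb_spec x p); inversion Hp; simpl in *; lia.
    + apply IHn; now inversion Hp.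
  - clear - Hn Hr. induction Hn as [|[p u] x ms row H Hn IHn]; [constructor|].
    inversion Hr as [|? ? ? ? Hx Hr']; subst. constructor; [|now apply IHn].
    cbn [fst snd] in *. rewrite Z.mul_1_l in *.
    destruct (Z.eqb_spec x p) as [->|]; destruct Hx as [z Hz]; [exists (z + 1)|exists z]; lia.
  - exists row; auto.
Qed.

(** Groups with a single form enter the marked sets. Groups with at most five forms are tried only
    on rows that survive the marks, where every form of the group must meet the row. Any selection
    of groups is sound, so the cutoff five only limits the work. *)
Definition leaf (T : rows) (fin : Z -> bool) (M0 : Z)
    (ms : list modulus) (rho : list Z) (gs : list (list (list Z))) (r : Z) : bool :=
  let gs := map (map (fun f => map2 sub_mod ms f rho)) gs in
  let singles := flat_map (fun g => match g with [f] => [f] | _ => [] end) gs in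
  let multi := filter (fun g => Nat.leb (length g) 5) gs in
  sieve (fun t row => if ex (all (fun f => meets f row)) multi then true else fin (r + M0 * t))
    (marks (length ms) singles) 0 T.

Lemma leaf_ok ps k T fin M0 c ms rho gs r t row :
  incl (map fst ms) ps -> Forall (fun m => (fst m | snd m * M0 - 1)) ms -> k = r + M0 * t ->
  in_rows t row 0 c T -> residues (map (fun m => (fst m, 1)) ms) row t ->
  residues ms rho r -> Forall (group_ok ps k ms) gs ->
  leaf T fin M0 ms rho gs r = true -> covered ps k \/ fin k = true.
Proof.
  intros Hps Hu Hk HT Hrow Hrho Hgs H. unfold leaf in H.
  set (sh := fun f => map2 sub_mod ms f rho) in H.
  assert (Hcov : forall g, In g gs -> (forall f, In f g -> meets (sh f) row = true) -> covered ps k).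
  { intros g Hg Hm. destruct (proj1 (Forall_forall _ _) Hgs g Hg) as [n [n1 Hn]].
    exists n; split; auto. intros i Hi. destruct (Hn i Hi) as [|[f [Hf Of]]]; auto.
    exact (meets_ok _ _ _ _ _ _ _ _ _ _ _ Hps Hu Hk Of Hrho Hrow (Hm f Hf)). }
  destruct (sieve_ok _ _ _ _ _ _ _ HT H) as [Hm|Hfb].
  - destruct (marked_marks _ _ _ Hm) as [f [Hf Hmf]]. left.
    apply in_flat_map in Hf. destruct Hf as [g' [Hg' Hf]].
    apply in_map_iff in Hg'. destruct Hg' as [g [Eg Hg]].
    apply (Hcov g Hg). intros f0 Hf0.
    destruct g' as [|f1 [|f2 g']]; simpl in Hf; try easy. destruct Hf as [->|[]].
    destruct g as [|f3 [|f4 g]]; simpl in Eg; try discriminate.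
    injection Eg as <-. destruct Hf0 as [<-|[]]. exact Hmf.
  - simpl in Hfb. destruct (ex _ _) eqn:He.
    + left. apply ex_spec in He. destruct He as [g' [Hg' Ha]].
      apply filter_In, proj1, in_map_iff in Hg'. destruct Hg' as [g [<- Hg]].
      apply (Hcov g Hg). intros f Hf.
      apply (all_spec _ _ Ha). apply in_map_iff. exists f; auto.
    + right. now rewrite Hk.
Qed.

(** * Depth-first search over residue classes *)

Fixpoint search (lf : list modulus -> list Z -> list (list (list Z)) -> Z -> bool) (d : nat)
    (ms : list modulus) (rho : list Z) (gs : list (list (list Z))) (r M : Z) : bool :=
  match d with
  | O => lf ms rho gs r
  | S d =>
    match ms with
    | [] => false
    | (p, u) :: ms' =>
      let delta := map (fun m => snd m * M mod fst m) ms in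
      (fix children (q : nat) (rho : list Z) (r : Z) : bool :=
        match q with
        | O => true
        | S q =>
          if match rho with
             | [] => false
             | x :: rho' =>
               let gs' := map (restrict x) gs in
               if ex (fun g => match g with [] => true | _ => false end) gs' then true
               else search lf d ms' rho' gs' r (M * p)
             end
          then children q (map2 add_mod ms rho delta) (r + M) else false
        end) (Z.to_nat p) rho r
    end
  end.

(** The class of [r] modulo [M] splits into the classes of [r + M * j] modulo [M * p], as in a
    mixed-radix expansion of [k]; [rho] carries [u * r] for all remaining moduli and is updated by
    addition. A class is settled as soon as some group becomes empty. *)
Lemma search_ok ps k (P : Prop) lf M0 d : forall ms rho gs r M,
  (forall rho gs r, 0 <= r < M0 -> (M0 | k - r) -> residues (skipn d ms) rho r ->
    Forall (group_ok ps k (skipn d ms)) gs -> lf (skipn d ms) rho gs r = true ->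
    covered ps k \/ P) ->
  M * fold_right Z.mul 1 (map fst (firstn d ms)) = M0 ->
  incl (map fst ms) ps -> Forall (fun m => 1 <= fst m) ms ->
  0 <= r < M -> (M | k - r) -> residues ms rho r -> Forall (group_ok ps k ms) gs ->
  search lf d ms rho gs r M = true -> covered ps k \/ P.
Proof.
  induction d as [|d IH]; intros ms rho gs r M Hlf HM Hps Hp Hr Hk Hrho Hgs.
  { simpl in *. rewrite Z.mul_1_r in HM. subst M. now apply Hlf. }
  destruct ms as [|[p u] ms]; [easy|]. simpl in HM.
  cbn [search]. assert (p1 : 1 <= p) by (now inversion Hp).
  destruct Hk as [z Hz].
  assert (Hj : 0 <= z mod p < p) by (apply Z.mod_pos_bound; lia).
  assert (Ediv := Z.div_mod z p ltac:(lia)).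
  set (children := fix children (q : nat) (rho : list Z) (r : Z) : bool := _).
  (* The inner loop visits [r], [r + M], and so on; with [q] rounds left it settles [k] if the class
     of [k] is [j < q] rounds ahead. At the start [j] is [z mod p], where [k - r = z * M]. *)
  enough (G : forall q rho r', residues ((p, u) :: ms) rho r' ->
    (exists j, 0 <= j < Z.of_nat q /\ 0 <= r' + M * j < M * p /\ (M * p | k - (r' + M * j))) ->
    children q rho r' = true -> covered ps k \/ P).
  { apply G; auto. exists (z mod p). split; [lia|]. split; [nia|].
    exists (z / p). rewrite Z.sub_add_distr, Hz. rewrite Ediv at 1. ring. }
  clear z Hz Hj Ediv rho Hrho r Hr.
  induction q as [|q IHq]; intros rho r Hrho [j [Hj [Hb Hd]]]; [lia|].
  cbn [children]. destruct rho as [|x rho]; [easy|].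
  destruct (ex _ _) eqn:He.
  - cbn [children] in *. destruct (Z.eq_dec j 0) as [->|j0].
    + intros _. left. rewrite Z.mul_0_r, Z.add_0_r in Hd.
      apply ex_spec in He. destruct He as [g' [Hg' Ng]]. destruct g'; [|easy].
      apply in_map_iff in Hg'. destruct Hg' as [g [Eg Hg]].
      apply (group_ok_nil ps k ms). rewrite <- Eg.
      apply (restrict_ok ps k p u ms x g).
      * apply Hps. now left.
      * inversion Hrho; subst. simpl in *.
        replace (u * k - x) with (u * (k - r) + (u * r - x)) by ring.
        apply Z.divide_add_r; auto. apply Z.divide_mul_r.
        apply Z.divide_trans with (M * p); auto. now exists M.
      * exact (proj1 (Forall_forall _ _) Hgs g Hg).
    + apply IHq; [apply residues_add; [assumption|now apply residues_mul]|].
      exists (j - 1). replace (r + M + M * (j - 1)) with (r + M * j) by ring. repeat split; auto; lia.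
  - destruct (search _ _ _ _ _ _ _) eqn:Hs; [|easy]. destruct (Z.eq_dec j 0) as [->|j0].
    + intros _. rewrite Z.mul_0_r, Z.add_0_r in Hd, Hb.
      inversion Hrho as [|? ? ? ? Hx Hrho']; subst. simpl in Hx.
      refine (IH ms rho _ r (M * p) _ _ _ _ Hb Hd Hrho' _ Hs); auto.
      * rewrite <- Z.mul_assoc. reflexivity.
      * intros q' Hq'. apply Hps. now right.
      * now inversion Hp.
      * apply Forall_forall. intros g' Hg'. apply in_map_iff in Hg'. destruct Hg' as [g [<- Hg]].
        apply (restrict_ok ps k p u ms x g).
        -- apply Hps. now left.
        -- replace (u * k - x) with (u * (k - r) + (u * r - x)) by ring.
           apply Z.divide_add_r; auto. apply Z.divide_mul_r.
           apply Z.divide_trans with (M * p); auto. now exists M.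
        -- exact (proj1 (Forall_forall _ _) Hgs g Hg).
    + apply IHq; [apply residues_add; [assumption|now apply residues_mul]|].
      exists (j - 1). replace (r + M + M * (j - 1)) with (r + M * j) by ring. repeat split; auto; lia.
Qed.

(** * The sieving primes, the forms and the computation *)

Definition small_primes : list Z := [2; 3; 5; 7; 11; 13].
Definition primorial : Z := 30030.
(** The primes from 17 to 503: trial division up to 19 suffices because [23 * 23 > 503]. *)
Definition large_primes : list Z :=
  filter (fun p => all (fun q => if p <=? q then true else negb (p mod q =? 0))
    [2; 3; 5; 7; 11; 13; 17; 19]) (map (Z.add 16) (zrange 487)).
Definition sieving_primes : list Z := small_primes ++ large_primes.

Definition inverse (p a : Z) : Z :=
  (fix go (n : nat) (x y : Z) := match n with
    | O => x
    | S n => if y =? 1 then x else go n (x + 1) (let z := y + a in if p <=? z then z - p else z)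
    end) (Z.to_nat p) 1 a.

Definition large_moduli : list modulus :=
  map (fun p => (p, inverse p (primorial mod p))) large_primes.
Definition moduli : list modulus := map (fun p => (p, 1)) small_primes ++ large_moduli.

(* Only 13-smooth [n], so that every form has a root modulo every large prime. *)
Definition multipliers : list Z :=
  [2; 3; 4; 5; 6; 7; 8; 9; 10; 11; 12; 13; 14; 15; 16; 18; 20; 21; 22; 24; 25; 26; 27; 28; 30].

(** For [i] not coprime to the smooth number [n], the form has a small prime factor for every [k]
    and is omitted. Otherwise the root is [- u * i / n] modulo [p], and there is none if [p] divides
    [n]. *)
Definition forms (n : Z) : list (Z * list Z) :=
  let slopes := map (fun m => (fst m, if n mod fst m =? 0 then 0
    else snd m * inverse (fst m) (n mod fst m) mod fst m)) moduli in
  map (fun i => (i, map (fun m => if snd m =? 0 then 0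
      else reduce (fst m) (snd m * (fst m - i mod fst m))) slopes))
    (filter (fun i => Z.gcd n i =? 1) (zrange (n - 1))).

Definition groups : list (list (list Z)) := map (fun n => map snd (forms n)) multipliers.

(* The inverse modulo [p] of the coordinate [u] of a modulus [(p, u)]. *)
Definition cofactor (u : Z) : Z := if u =? 1 then 1 else primorial.

(** The roots computed by [forms] are certified by substitution: the coordinate [x] stands for [k]
    congruent to [cofactor u * x]. *)
Fixpoint roots_ok (ms : list modulus) (n i : Z) (f : list Z) : bool :=
  match ms, f with
  | [], [] => true
  | (p, u) :: ms, x :: f =>
    if (if x =? 0 then true else (cofactor u * x * n + i) mod p =? 0)
    then roots_ok ms n i f else false
  | _, _ => false
  end.

Definition units_okb (w : Z -> Z) (ms : list modulus) : bool :=
  all (fun m => if fst m <=? 1 then false else (snd m * w (snd m) - 1) mod fst m =? 0) ms.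

Lemma units_ok w ms : units_okb w ms = true ->
  Forall (fun m => 1 < fst m /\ (fst m | snd m * w (snd m) - 1)) ms.
Proof.
  intros H. apply Forall_forall. intros m Hm. assert (H1 := all_spec _ _ H m Hm). cbv beta in H1.
  destruct (Z.leb_spec (fst m) 1); [easy|]. apply Z.eqb_eq, Z.mod_divide in H1; auto; lia.
Qed.

Lemma roots_ok_form k n i ms f :
  Forall (fun m => 1 < fst m /\ (fst m | snd m * cofactor (snd m) - 1)) ms ->
  roots_ok ms n i f = true -> form_ok k ms n i f.
Proof.
  revert f; induction ms as [|[p u] ms IH]; intros [|x f] Hu; simpl; try easy; [constructor|].
  inversion Hu as [|? ? [Hp1 Hu1] Hu2]; subst. cbn [fst snd] in *.
  destruct (Z.eqb_spec x 0) as [->|x0]; intros H.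
  - constructor; [easy|]. now apply IH.
  - destruct (Z.eqb_spec ((cofactor u * x * n + i) mod p) 0) as [e|]; [|easy].
    constructor; [|now apply IH]. cbn [fst snd]. intros _ Hk.
    apply Z.mod_divide in e; [|lia].
    replace (k * n + i) with ((cofactor u * x * n + i) + n * cofactor u * (u * k - x)
      - n * k * (u * cofactor u - 1)) by ring.
    apply Z.divide_sub_r; [apply Z.divide_add_r; auto|]; now apply Z.divide_mul_r.
Qed.

Definition group_okb (n : Z) : bool :=
  let fs := forms n in
  if 1 <? n then
    all (fun i =>
      if ex (fun p => if n mod p =? 0 then i mod p =? 0 else false) small_primes then true
      else ex (fun g => if fst g =? i then roots_ok moduli n i (snd g) else false) fs)
    (zrange (n - 1))
  else false.

Lemma moduli_ok : units_okb cofactor moduli = true.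
Proof. vm_cast_no_check (eq_refl true). Qed.

Lemma large_moduli_ok : units_okb (fun _ => primorial) large_moduli = true.
Proof. vm_cast_no_check (eq_refl true). Qed.

Lemma sieving_primes_ok : all (fun p => if p <=? 1 then false else p <=? 503) sieving_primes = true.
Proof. vm_cast_no_check (eq_refl true). Qed.

Lemma groups_okb : all group_okb multipliers = true.
Proof. vm_cast_no_check (eq_refl true). Qed.

Lemma moduli_primes : map fst moduli = sieving_primes.
Proof. vm_cast_no_check (eq_refl sieving_primes). Qed.

Lemma groups_ok k : Forall (group_ok sieving_primes k moduli) groups.
Proof.
  unfold groups. apply Forall_map, Forall_forall. intros n Hn.
  assert (H := all_spec _ _ groups_okb n Hn). unfold group_okb in H.
  destruct (Z.ltb_spec 1 n) as [n1|]; [|easy]. exists n; split; auto. intros i Hi.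
  assert (Hi' := all_spec _ _ H i ltac:(apply in_zrange; lia)). cbv beta in Hi'.
  destruct (ex _ small_primes) eqn:E.
  - left. apply ex_spec in E. destruct E as [p [Hp E]].
    assert (Hps : In p sieving_primes) by (apply in_or_app; auto).
    assert (H1 := all_spec _ _ sieving_primes_ok p Hps). cbv beta in H1.
    destruct (Z.leb_spec p 1); [easy|].
    destruct (Z.eqb_spec (n mod p) 0) as [e|]; [|easy]. apply Z.eqb_eq in E.
    exists p; split; auto. apply Z.mod_divide in e, E; try lia.
    apply Z.divide_add_r; auto. now apply Z.divide_mul_r.
  - right. apply ex_spec in Hi'. destruct Hi' as [[j f] [Hg Hr]]. cbn [fst snd] in Hr.
    destruct (Z.eqb_spec j i) as [->|]; [|easy].
    exists f. split; [apply in_map_iff; exists (i, f); auto|].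
    exact (roots_ok_form k n i _ f (units_ok _ _ moduli_ok) Hr).
Qed.

Definition exceptions : list (Z * Z * list Z) :=
  [(920919, 2, [1033]); (1089275, 2, [1471]); (1370564, 2, [673]); (1483845, 4, [929]);
   (1517529, 5, [29; 2267]); (1596363, 14, [1367; 2213]); (1864863, 4, [1931]); (2216514, 3,
   [769]); (2500035, 2, [1429]); (2617055, 3, [2357]); (2709153, 2, [613]); (2732835, 5, [607;
   3593]); (3050013, 10, [197; 2687]); (3265955, 2, [2521]); (3470906, 5, [2111]); (3474680, 4,
   [547]); (4063149, 2, [971]); (4064675, 4, [877]); (4333706, 5, [19; 2591]); (4627245, 2,
   [2099]); (5182106, 5, [2081]); (5450834, 4, [2647]); (5661290, 2, [1789]); (5913746, 2,
   [2543]); (6316625, 2, [631]); (6440060, 3, [3709]); (7429016, 5, [97; 953]); (7585424, 5,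
   [3371]); (7796789, 5, [1439]); (7814715, 2, [547]); (7904939, 2, [619]); (8243354, 2,
   [1409]); (8336174, 12, [131; 3023]); (8467106, 7, [2161]); (8797955, 6, [1373]); (8850065,
   9, [23; 3209]); (9133586, 4, [1213]); (9348050, 4, [4729]); (9502646, 6, [661]); (9775185,
   2, [4157]); (9821889, 6, [2857]); (9975284, 11, [31; 43; 4919]); (10248069, 6, [2237]);
   (10735520, 4, [1013]); (10988595, 5, [1979]); (11030534, 4, [2591]); (11101670, 2, [2129]);
   (11142935, 6, [2731]); (11590550, 2, [1117]); (11863929, 2, [2237]); (11931984, 2, [547]);
   (11932965, 2, [1129]); (12320924, 4, [839]); (12524246, 2, [3319]); (12540450, 4, [2137]);
   (12763584, 2, [991]); (13267863, 3, [3529]); (13462694, 2, [3823]); (13853609, 2, [887]);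
   (14017856, 3, [691]); (14710730, 3, [2879]); (15064595, 2, [2861]); (15081495, 5, [5479]);
   (16029866, 3, [2311]); (16816694, 2, [547]); (16955225, 2, [673]); (17017664, 2, [4649]);
   (17119226, 3, [2963]); (17284196, 5, [3617]); (17520986, 3, [2053]); (17585973, 6, [5569]);
   (17861570, 3, [2377]); (18070065, 6, [5749]); (18160023, 2, [2521]); (18900434, 2, [4657]);
   (19136865, 10, [29; 5851]); (19161266, 2, [1303]); (19312215, 11, [29; 3923]); (19509560, 2,
   [1697]); (19518260, 2, [1949]); (19614320, 6, [5113]); (19719519, 4, [1201]); (19870473, 3,
   [3821]); (20027084, 2, [5527]); (20426379, 2, [4441]); (21123003, 11, [9151]); (21125234, 4,
   [3217]); (21255794, 3, [5119]); (21293150, 3, [4093]); (21328370, 2, [5297]); (21470540, 2,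
   [787]); (21597234, 3, [2137]); (22130885, 6, [1453]); (22146453, 2, [1847]); (22851633, 2,
   [1747]); (22986159, 2, [3001]); (23840244, 2, [1951]); (24106655, 2, [5987]); (24181443, 2,
   [1723]); (24253964, 3, [1979]); (24299429, 2, [569]); (24384815, 4, [653]); (24737049, 2,
   [6257]); (25415865, 3, [5557]); (25734470, 3, [8221]); (25826675, 8, [197; 3739]);
   (25999784, 3, [5399]); (26277734, 3, [1361]); (26294036, 4, [619]); (26998209, 5, [257;
   991]); (27134499, 3, [1033]); (27166029, 2, [5659]); (27216245, 7, [73; 1249]); (27636854,
   3, [7873]); (27738935, 4, [2113]); (29197466, 7, [5437]); (29716434, 6, [6121]); (30028646,
   2, [1051]); (30152714, 3, [4909]); (30208695, 2, [4483]); (30786020, 3, [829]); (30959664,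
   2, [977]); (30963555, 3, [4973]); (31189430, 2, [1543]); (31370084, 6, [1019]); (31519745,
   2, [601]); (31593744, 5, [1301]); (31647909, 2, [2467]); (31771725, 6, [1291]); (32369154,
   3, [6173]); (32452713, 2, [1847]); (32532969, 6, [4651]); (32729943, 3, [4159]); (32971166,
   3, [8731]); (33510885, 3, [1381]); (33659625, 2, [719]); (34221033, 4, [6367]); (34475636,
   3, [593]); (35059893, 2, [7933]); (35118824, 2, [3911]); (35125685, 3, [2699]); (35143295,
   2, [4049]); (35446665, 6, [12007]); (35527023, 2, [853]); (37892763, 2, [1283]); (38120445,
   4, [631]); (38499335, 2, [1481]); (38561145, 8, [1381]); (38758874, 6, [3163]); (39137835,
   5, [911]); (39247355, 2, [1723]); (39270446, 2, [709]); (39293834, 3, [563]); (39615015, 3,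
   [643]); (39759839, 3, [3889]); (39854969, 2, [1381]); (39882224, 5, [8941]); (40319936, 6,
   [107; 5813]); (40617933, 2, [1439]); (40940606, 3, [8537]); (40988750, 4, [11471]);
   (41453489, 2, [1327]); (41627034, 2, [5657]); (41763423, 6, [4703]); (41770484, 2, [1657]);
   (42658293, 3, [9929]); (43042055, 4, [883]); (43615209, 2, [1543]); (43894004, 2, [4177]);
   (44137184, 8, [947]); (44176614, 2, [4049]); (44436735, 2, [857]); (45122846, 2, [643]);
   (45411015, 2, [5051]); (45680760, 2, [3191]); (45780063, 2, [563]); (45900974, 3, [601]);
   (46630233, 6, [9439]); (47070176, 6, [6449]); (47199320, 3, [1367]); (47501454, 4, [3323]);
   (48006363, 6, [1091]); (48301055, 2, [2311]); (48994329, 2, [1669]); (49211463, 2, [2473]);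
   (49297535, 4, [3323]); (49623624, 3, [1607]); (49767333, 4, [5417])].

(* For [k <= 503] a factor found by the sieve could be [k n + i] itself; these [k] are
   treated by [small_check]. *)
Definition in_exceptions (k : Z) : bool :=
  if k <=? 503 then true else ex (fun e => fst (fst e) =? k) exceptions.

(* [30030 * 1666 > 50000000]. *)
Definition residue_rows : rows :=
  split_rows 2 0 large_moduli (make_rows 1666 large_moduli 0 (map fst large_moduli)).

(** The six levels are the primes up to 13. The search starts from the class of [0] modulo [1],
    whose coordinates are all written [p], since residues lie in [[1 .. p]]. *)
Lemma search_check :
  search (leaf residue_rows in_exceptions primorial) 6 moduli (map fst moduli) groups 0 1 = true.
Proof. vm_cast_no_check (eq_refl true). Qed.

Lemma in_exceptions_ok k : 503 < k -> in_exceptions k = true ->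
  exists n qs, In (k, n, qs) exceptions.
Proof.
  unfold in_exceptions. intros Hk H. destruct (Z.leb_spec k 503); [lia|].
  apply ex_spec in H. destruct H as [[[k' n] qs] [He H]]. apply Z.eqb_eq in H.
  cbn [fst] in H. subst k'. now exists n, qs.
Qed.

Lemma large_moduli_length : (2 <= length large_moduli)%nat.
Proof. apply Nat.leb_le. vm_cast_no_check (eq_refl true). Qed.

Lemma in_residue_rows t row : normal large_moduli row ->
  In (t, row) (make_rows 1666 large_moduli 0 (map fst large_moduli)) ->
  in_rows t row 0 2 residue_rows.
Proof. exact (in_split_rows large_moduli t row 2 0 _ large_moduli_length). Qed.

Opaque large_moduli sieving_primes residue_rows in_exceptions groups exceptions.

Lemma covered_in_exceptions k : 0 <= k <= 50000000 ->
  covered sieving_primes k \/ in_exceptions k = true.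
Proof.
  intros Hk.
  assert (Hl := units_ok _ _ large_moduli_ok).
  assert (Hpos : Forall (fun m : modulus => 1 <= fst m) moduli).
  { eapply Forall_impl; [|exact (units_ok _ _ moduli_ok)]. intros m [Hm _]. lia. }
  assert (Hlpos : Forall (fun m : modulus => 1 <= fst m) large_moduli).
  { eapply Forall_impl; [|exact Hl]. intros m [Hm _]. lia. }
  assert (Hincl : incl (map fst moduli) sieving_primes).
  { rewrite moduli_primes. apply incl_refl. }
  assert (Hskip : skipn 6 moduli = large_moduli) by reflexivity.
  refine (search_ok sieving_primes k (in_exceptions k = true) (leaf residue_rows in_exceptions primorial)
    primorial 6 moduli (map fst moduli) groups 0 1 _ _ Hincl Hpos _ _ _ (groups_ok k) search_check).
  - rewrite Hskip. intros rho gs r Hr [t Ht] Hrho Hgs.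
    assert (Ht0 : 0 <= t < 0 + Z.of_nat 1666) by (unfold primorial in *; lia).
    destruct (in_make_rows 1666 large_moduli 0 (map fst large_moduli) Hlpos) with (t := t)
      as [row [Hin [Hn Hrow]]]; auto.
    + clear - Hlpos. induction Hlpos; constructor; auto. lia.
    + clear. induction large_moduli as [|m ms IH]; constructor; auto.
      exists (-1). cbn [fst snd]. ring.
    + refine (leaf_ok sieving_primes k residue_rows in_exceptions primorial 2 large_moduli rho gs r t row
        _ _ _ _ Hrow Hrho Hgs).
      * intros p Hp. apply Hincl. unfold moduli. rewrite map_app. apply in_or_app. now right.
      * eapply Forall_impl; [|exact Hl]. now intros m [_ Hm].
      * lia.
      * exact (in_residue_rows t row Hn Hin).
  - reflexivity.
  - lia.
  - apply Z.divide_1_l.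
  - clear. induction moduli as [|m ms IH]; constructor; auto. exists (-1). ring.
Qed.

(** * From divisors to prime-free intervals *)

Definition composite_by (qs : list Z) (x : Z) : bool :=
  ex (fun q => if q <=? 1 then false else if q <? x then x mod q =? 0 else false) qs.

Lemma composite_by_ok qs x : composite_by qs x = true -> ~ prime x.
Proof.
  intros H Hx. apply ex_spec in H. destruct H as [q [_ H]].
  destruct (Z.leb_spec q 1); [easy|]. destruct (Z.ltb_spec q x); [|easy].
  apply Z.eqb_eq, Z.mod_divide in H; [|lia].
  destruct (prime_divisors x Hx q H) as [|[|[|]]]; lia.
Qed.

Definition composite_run (qs : list Z) (k n : Z) : bool :=
  if 1 <? n then all (fun i => composite_by qs (k * n + i)) (zrange (n - 1)) else false.

Definition prime_free_multiple (k : Z) : Prop :=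
  exists n, 1 < n /\ forall p, prime p -> ~ k * n < p < (k + 1) * n.

Lemma composite_run_ok qs k n : composite_run qs k n = true -> prime_free_multiple k.
Proof.
  unfold composite_run. destruct (Z.ltb_spec 1 n) as [n1|]; [|easy]. intros H.
  exists n; split; auto. intros p Hp Hkp.
  apply (composite_by_ok qs p); auto.
  replace p with (k * n + (p - k * n)) by ring.
  apply (all_spec _ _ H). apply in_zrange. lia.
Qed.

(** A number between [k n] and [(k + 1) n] exceeds 503, so a sieving prime dividing it is a proper
    divisor. *)
Lemma covered_ok k : 503 < k -> covered sieving_primes k -> prime_free_multiple k.
Proof.
  intros Hk [n [n1 H]]. exists n; split; auto. intros p Hp Hkp.
  destruct (H (p - k * n)) as [q [Hq Hd]]; [lia|].
  replace (k * n + (p - k * n)) with p in Hd by ring.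
  assert (H1 := all_spec _ _ sieving_primes_ok q Hq). cbv beta in H1.
  destruct (Z.leb_spec q 1); [easy|]. apply Z.leb_le in H1.
  destruct (prime_divisors p Hp q Hd) as [|[|[|]]]; nia.
Qed.

Lemma exceptions_check :
  all (fun e => composite_run (small_primes ++ snd e) (fst (fst e)) (snd (fst e))) exceptions = true.
Proof. vm_cast_no_check (eq_refl true). Qed.

(** For these [k] some [n <= 9] always works, with divisors checked to be proper. *)
Lemma small_check :
  all (fun k => if ex (Z.eqb k) [1; 2; 3; 5; 9; 14] then true
    else ex (composite_run sieving_primes k) (zrange 9)) (zrange 503) = true.
Proof. vm_cast_no_check (eq_refl true). Qed.

Lemma prime_free_multiple_exists k : 1 <= k <= 50000000 -> ~ In k [1; 2; 3; 5; 9; 14] ->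
  prime_free_multiple k.
Proof.
  intros Hk Hnot. destruct (Z_le_gt_dec k 503) as [small|large].
  - assert (H := all_spec _ _ small_check k ltac:(apply in_zrange; lia)). cbv beta in H.
    destruct (ex (Z.eqb k) _) eqn:E.
    + apply ex_spec in E. destruct E as [x [Hx E]]. apply Z.eqb_eq in E. now subst x.
    + apply ex_spec in H. destruct H as [n [_ H]]. exact (composite_run_ok _ _ _ H).
  - destruct (covered_in_exceptions k) as [H|H]; [lia| |].
    + apply covered_ok; auto; lia.
    + destruct (in_exceptions_ok k ltac:(lia) H) as [n [qs He]].
      exact (composite_run_ok _ _ _ (all_spec _ _ exceptions_check _ He)).
Qed.

(** * Primes between [14 n] and [15 n], for small [n] *)

Fixpoint no_odd_divisor (fuel : nat) (p d : Z) : bool :=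
  match fuel with
  | O => false
  | S fuel =>
    if p <? d * d then true
    else if p mod d =? 0 then false else no_odd_divisor fuel p (d + 2)
  end.

(** Only soundness matters, so 2 may be rejected. The fuel lets [d] reach 5401, whose square exceeds
    the largest number tested, 25825663. *)
Definition is_prime (p : Z) : bool :=
  if p <=? 2 then false else if p mod 2 =? 0 then false else no_odd_divisor 2700 p 3.

Lemma no_odd_divisor_ok fuel p d q : no_odd_divisor fuel p d = true ->
  p mod 2 <> 0 -> d mod 2 = 1 -> 0 < d <= q -> q * q <= p -> ~ (q | p).
Proof.
  revert d; induction fuel as [|fuel IH]; intros d; [easy|]. cbn [no_odd_divisor].
  destruct (Z.ltb_spec p (d * d)); [nia|].
  destruct (Z.eqb_spec (p mod d) 0) as [|Hd]; [easy|]. intros H0 Hp Hd2 Hq Hqq Hdiv.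
  destruct (Z.eq_dec q d) as [->|ne]; [now apply Hd, Z.mod_divide; [lia|]|].
  (* The even number [d + 1], skipped by the loop, cannot divide the odd [p]. *)
  destruct (Z.eq_dec q (d + 1)) as [->|ne'].
  - apply Hp, Z.mod_divide; [lia|]. apply Z.divide_trans with (d + 1); auto.
    apply Z.mod_divide; [lia|]. rewrite Z.add_mod, Hd2 by lia. reflexivity.
  - apply (IH (d + 2)) in H0; auto; [|lia]. rewrite Z.add_mod, Hd2 by lia. reflexivity.
Qed.

Lemma is_prime_ok p : is_prime p = true -> prime p.
Proof.
  unfold is_prime. destruct (Z.leb_spec p 2); [easy|].
  destruct (Z.eqb_spec (p mod 2) 0) as [|Hp]; [easy|].
  generalize 2700%nat. intros fuel H1.
  assert (G : forall q, 1 < q -> q * q <= p -> ~ (q | p)).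
  { intros q Hq Hqq. destruct (Z.eq_dec q 2) as [->|].
    - intros Hd. now apply Hp, Z.mod_divide.
    - apply (no_odd_divisor_ok _ _ _ q H1); auto; lia. }
  apply prime_alt. split; [lia|]. intros n Hn [m Hm].
  destruct (Z_le_gt_dec (n * n) p) as [le|gt].
  - apply (G n); auto; [lia|]. now exists m.
  - apply (G m); [nia|nia|]. exists n. lia.
Qed.

Fixpoint prime_chain (p : Z) (l : list Z) : bool :=
  match l with
  | [] => true
  | q :: l => if is_prime q then if 14 * q <? 15 * p then prime_chain q l else false else false
  end.

(** The first member [q] of the chain beyond [14 n] works: its predecessor [p] is at most [14 n], so
    [14 q < 15 p <= 14 * 15 n]. *)
Lemma prime_chain_ok p l n : 0 < n -> prime_chain p l = true -> p <= 14 * n -> 14 * n < last l 0 ->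
  exists q, prime q /\ 14 * n < q < 15 * n.
Proof.
  intros Hn. revert p; induction l as [|q l IH]; intros p.
  { intros _ _ Hl. change (last [] 0) with 0 in Hl. lia. }
  cbn [prime_chain].
  destruct (is_prime q) eqn:Hq; [|easy]. destruct (Z.ltb_spec (14 * q) (15 * p)); [|easy].
  intros Hc Hp Hl. destruct (Z_lt_le_dec (14 * n) q).
  - exists q. split; [now apply is_prime_ok|lia].
  - apply (IH q); auto. destruct l; [|exact Hl].
    change (last [q] 0) with q in Hl. lia.
Qed.

Definition chain : list Z :=
  [2971; 3181; 3407; 3643; 3889; 4159; 4451; 4759; 5087; 5449; 5827; 6229; 6673; 7129; 7621;
   8161; 8741; 9349; 10009; 10723; 11483; 12301; 13177; 14107; 15107; 16183; 17333; 18553;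
   19867; 21283; 22787; 24413; 26153; 28019; 30013; 32143; 34429; 36887; 39521; 42337; 45361;
   48593; 52057; 55763; 59743; 64007; 68567; 73459; 78697; 84317; 90313; 96763; 103669; 111053;
   118973; 127453; 136547; 146299; 156733; 167917; 179909; 192757; 206519; 221261; 237053;
   253969; 272093; 291521; 312343; 334651; 358541; 384151; 411589; 440987; 472477; 506213;
   542371; 581101; 622607; 667021; 714619; 765659; 820343; 878929; 941701; 1008947; 1080983;
   1158187; 1240861; 1329479; 1424441; 1526179; 1635187; 1751947; 1877077; 2011147; 2154793;
   2308699; 2473589; 2650259; 2839553; 3042367; 3259667; 3492493; 3741943; 4009219; 4295587;
   4602407; 4931149; 5283359; 5660731; 6065053; 6498229; 6962377; 7459679; 7992511; 8563403;
   9175073; 9830413; 10532581; 11284907; 12090959; 12954587; 13879907; 14871313; 15933523;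
   17071627; 18291019; 19597511; 20997313; 22497091; 24103973; 25825663].

Lemma chain_check : prime_chain 2797 chain = true.
Proof. vm_cast_no_check (eq_refl true). Qed.

Definition prime_in (a b : Z) : bool :=
  ex is_prime (map (Z.add a) (zrange (b - a - 1))).

Lemma prime_in_ok a b : prime_in a b = true -> exists p, prime p /\ a < p < b.
Proof.
  intros H. apply ex_spec in H. destruct H as [p [Hp H]]. exists p. split; [now apply is_prime_ok|].
  apply in_map_iff in Hp. destruct Hp as [i [<- Hi]].
  apply in_map_iff in Hi. destruct Hi as [j [<- Hj]]. apply in_seq in Hj. lia.
Qed.

Lemma small_14_15 :
  all (fun n => if n <=? 1 then true else prime_in (14 * n) (15 * n)) (zrange 199) = true.
Proof. vm_cast_no_check (eq_refl true). Qed.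

Lemma small_multiples :
  all (fun k => all (fun n => if n <=? 1 then true else prime_in (k * n) ((k + 1) * n)) (zrange 41))
    [1; 2; 3; 5; 9] = true.
Proof. vm_cast_no_check (eq_refl true). Qed.

(** * Primes between [14 n] and [15 n], for large [n] *)

Module Chebyshev.

Import ssreflect ssrfun ssrbool eqtype ssrnat seq div choice fintype bigop prime.
Local Set Implicit Arguments.
Local Unset Strict Implicit.
Local Unset Printing Implicit Defensive.
Local Open Scope nat_scope.
Local Open Scope R_scope.

(** * Finite real sums *)

Definition rsum (A : Type) (s : seq A) (f : A -> R) : R :=
  foldr (fun x t => f x + t) 0 s.

Lemma rsum_le (A : Type) (s : seq A) (f g : A -> R) :
  (forall x, f x <= g x) -> rsum s f <= rsum s g.
Proof. by move=> fg; elim: s => [|x s IH] /=; [lra | have := fg x; lra]. Qed.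

Lemma eq_rsum (A : Type) (s : seq A) (f g : A -> R) : f =1 g -> rsum s f = rsum s g.
Proof. by move=> fg; elim: s => [|x s IH] //=; rewrite fg IH. Qed.

Lemma eq_rsum_in (A : eqType) (s : seq A) (f g : A -> R) :
  {in s, f =1 g} -> rsum s f = rsum s g.
Proof.
elim: s => [|x s IH] //= fg; rewrite fg ?mem_head // IH // => y ys.
by apply: fg; rewrite inE ys orbT.
Qed.

Lemma rsum0 (A : Type) (s : seq A) : rsum s (fun=> 0) = 0.
Proof. by elim: s => //= x s ->; lra. Qed.

Lemma rsumD (A : Type) (s : seq A) (f g : A -> R) :
  rsum s (fun x => f x + g x) = rsum s f + rsum s g.
Proof. by elim: s => /= [|x s ->]; lra. Qed.

Lemma rsumM (A : Type) (s : seq A) (c : R) (f : A -> R) :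
  rsum s (fun x => c * f x) = c * rsum s f.
Proof. by elim: s => /= [|x s ->]; lra. Qed.

Lemma rsum_cat (A : Type) (s t : seq A) (f : A -> R) :
  rsum (s ++ t) f = rsum s f + rsum t f.
Proof. by elim: s => /= [|x s ->]; lra. Qed.

Lemma INR_sum (s : seq nat) (F : nat -> nat) :
  INR (\sum_(i <- s) F i) = rsum s (fun i => INR (F i)).
Proof. by elim: s => [|x s IH]; rewrite ?big_nil ?big_cons //= plus_INR IH. Qed.

Lemma INR_gt0 n : (0 < n)%N -> 0 < INR n.
Proof. by move=> n0; apply: lt_0_INR; apply/ltP. Qed.

Lemma INR_leq m n : (m <= n)%N -> INR m <= INR n.
Proof. by move=> mn; apply: le_INR; apply/leP. Qed.

Lemma ln_INR_ge0 n : 0 <= ln (INR n).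
Proof.
case: n => [|n].
  rewrite /ln; destruct (Rlt_dec 0 (INR 0)) as [h|h]; last by lra.
  by exfalso; move: h; rewrite /=; lra.
have [->|n0] := posnP n; first by rewrite ln_1; lra.
by apply: Rlt_le; rewrite -ln_1; apply: ln_increasing; [lra | apply: (lt_INR 1); apply/ltP].
Qed.

(* The sum of [Lambda(k) g(k)] over the prime powers [k = p ^ i] with [p, i <= Y]; for [g]
   supported on [1 .. Y] the truncation is harmless. *)
Definition psum (Y : nat) (g : nat -> R) : R :=
  rsum (iota 0 Y.+1) (fun p =>
    if prime p then ln (INR p) * rsum (iota 1 Y) (fun i => g (p ^ i)%N) else 0).

Lemma psum_le Y g h : (forall k, (0 < k)%N -> g k <= h k) -> psum Y g <= psum Y h.
Proof.
move=> gh; apply: rsum_le => p; case: ifP => [pp|_]; last lra.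
apply: Rmult_le_compat_l; first exact: ln_INR_ge0.
by apply: rsum_le => i; apply: gh; rewrite expn_gt0 prime_gt0.
Qed.

Lemma eq_psum Y g h : (forall k, (0 < k)%N -> g k = h k) -> psum Y g = psum Y h.
Proof. by move=> gh; apply: Rle_antisym; apply: psum_le => k /gh ->; lra. Qed.

Lemma psumD Y g h : psum Y (fun k => g k + h k) = psum Y g + psum Y h.
Proof.
rewrite /psum -rsumD; apply: eq_rsum => p; case: ifP => _; last lra.
by rewrite rsumD; lra.
Qed.

Lemma psumM Y c g : psum Y (fun k => c * g k) = c * psum Y g.
Proof.
rewrite /psum -rsumM; apply: eq_rsum => p; case: ifP => _; last lra.
by rewrite rsumM; lra.
Qed.

Lemma psum_rsum (A : Type) (s : seq A) (f : A -> nat -> R) Y :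
  psum Y (fun k => rsum s (fun x => f x k)) = rsum s (fun x => psum Y (f x)).
Proof.
elim: s => [|x s IH] /=; last by rewrite psumD IH.
rewrite /psum -[RHS](rsum0 (iota 0 Y.+1)); apply: eq_rsum => p.
by case: ifP => // _; rewrite rsum0; lra.
Qed.

(** * Logarithms of integers and factorials as sums of [Lambda] *)

Lemma ln_INR_prod (s : seq nat) (F : nat -> nat) : (forall i, (0 < F i)%N) ->
  ln (INR (\prod_(i <- s) F i)) = rsum s (fun i => ln (INR (F i))).
Proof.
move=> F0; elim: s => [|x s IH]; first by rewrite big_nil ln_1.
rewrite big_cons /= mult_INR ln_mult ?IH //; apply: INR_gt0 => //.
exact: prodn_gt0.
Qed.

Lemma ln_expn p k : (0 < p)%N -> ln (INR (p ^ k)) = INR k * ln (INR p).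
Proof.
move=> p0; elim: k => [|k IH]; first by rewrite expn0 ln_1 /=; lra.
rewrite expnS mult_INR ln_mult ?IH ?S_INR; first lra.
  exact: INR_gt0.
by apply: INR_gt0; rewrite expn_gt0 p0.
Qed.

(** The identity [ln n = sum_(d | n) Lambda(d)], read off from the prime factorisation. *)
Lemma ln_psum Y n : (0 < n <= Y)%N -> ln (INR n) = psum Y (fun k => INR (k %| n)).
Proof.
move=> /andP[n0 nY].
rewrite -{1}(partnT n0) (widen_partn predT nY) ln_INR_prod; last first.
  by move=> [|p]; rewrite ?expn_gt0 // lognE.
rewrite /psum /index_iota subn0; apply: eq_rsum => p.
case: ifP => [pp|npp]; last by rewrite lognE npp /= ln_1.
rewrite ln_expn ?prime_gt0 // Rmult_comm; congr (_ * _).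
rewrite (logn_count_dvd n pp) INR_sum /index_iota.
(* Exponents [i >= n] contribute nothing, because [p ^ i > i >= n]. *)
have -> : Y = (n - 1 + (Y - n).+1)%N by rewrite addnS -addSn -subSn // subn1 /= subnKC.
rewrite iotaD rsum_cat; set t := iota (1 + _)%N _.
rewrite (@eq_rsum_in _ t _ (fun=> 0)) ?rsum0; first lra.
move=> i; rewrite mem_iota subnKC // => /andP[ni _].
by rewrite gtnNdvd // (leq_ltn_trans ni) // ltn_expl // prime_gt1.
Qed.

Lemma ln_fact_psum Y n : (n <= Y)%N -> ln (INR n`!) = psum Y (fun k => INR (n %/ k)).
Proof.
elim: n => [|n IH] nY.
  rewrite fact0 ln_1 -[LHS](Rmult_0_l (psum Y (fun=> 0))) -psumM.
  by apply: eq_psum => k _; rewrite div0n /=; lra.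
rewrite factS mult_INR ln_mult; [|exact: INR_gt0|by apply: INR_gt0; exact: fact_gt0].
rewrite IH 1?ltnW // (@ln_psum Y) // -psumD; apply: eq_psum => k k0.
by rewrite divnS // plus_INR.
Qed.

(** Chebyshev's function for [z <= Y]; a common [Y] lets sums for different [z] be compared
    termwise. *)
Definition psi Y z := psum Y (fun k => INR (k <= z)%N).

(** * Stirling-type bounds *)

Lemma ln_le_sub1 x : 0 < x -> ln x <= x - 1.
Proof.
move=> x0; have := exp_ineq1_le (ln x); rewrite exp_ln //; lra.
Qed.

Lemma ln_succ_bounds n : (0 < n)%N ->
  1 <= (INR n + 1) * (ln (INR n.+1) - ln (INR n)) /\
  INR n * (ln (INR n.+1) - ln (INR n)) <= 1.
Proof.
move=> n0; have N0 := INR_gt0 n0; have N1 := @INR_gt0 n.+1 isT.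
have -> : INR n.+1 = INR n + 1 by rewrite S_INR.
split.
- have := @ln_le_sub1 (INR n / (INR n + 1)).
  rewrite /Rdiv ln_mult ?ln_Rinv; [|lra|lra|by apply: Rinv_0_lt_compat; lra].
  move=> H; have {}H : ln (INR n + 1) - ln (INR n) >= / (INR n + 1).
    have : INR n * / (INR n + 1) - 1 = - / (INR n + 1) by field; lra.
    have : 0 < INR n * / (INR n + 1).
      by apply: Rmult_lt_0_compat => //; apply: Rinv_0_lt_compat; lra.
    by move=> h; move: (H h); lra.
  apply: (Rle_trans _ ((INR n + 1) * / (INR n + 1))); first by rewrite Rinv_r; lra.
  by apply: Rmult_le_compat_l; lra.
- have := @ln_le_sub1 ((INR n + 1) / INR n).
  rewrite /Rdiv ln_mult ?ln_Rinv; [|lra|lra|exact: Rinv_0_lt_compat].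
  move=> H; have {}H : ln (INR n + 1) - ln (INR n) <= / INR n.
    have : (INR n + 1) * / INR n - 1 = / INR n by field; lra.
    have : 0 < (INR n + 1) * / INR n.
      by apply: Rmult_lt_0_compat; [lra | exact: Rinv_0_lt_compat].
    by move=> h; move: (H h); lra.
  apply: (Rle_trans _ (INR n * / INR n)); last by rewrite Rinv_r; lra.
  by apply: Rmult_le_compat_l; lra.
Qed.

(** A primitive of [ln], the main term of [ln x!]. *)
Definition xlnx x := x * ln x - x.

Lemma xlnx_le x y : 1 <= x <= y -> xlnx x <= xlnx y.
Proof.
move=> [x1 xy]; rewrite /xlnx.
have lx : 0 <= ln x.
  case: (Req_dec x 1) => [->|?]; first by rewrite ln_1; lra.
  by apply: Rlt_le; rewrite -ln_1; apply: ln_increasing; lra.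
have := @ln_le_sub1 (x / y).
rewrite /Rdiv ln_mult ?ln_Rinv; [|lra|lra|by apply: Rinv_0_lt_compat; lra].
move=> H; have {}H : y * (ln x + - ln y) <= x - y.
  have -> : x - y = y * (x * / y - 1) by field; lra.
  apply: Rmult_le_compat_l; first lra; apply: H.
  by apply: Rmult_lt_0_compat; [lra | apply: Rinv_0_lt_compat; lra].
nra.
Qed.

Lemma ln_fact_bounds n : (0 < n)%N ->
  xlnx (INR n) + 1 <= ln (INR n`!) <= xlnx (INR n) + ln (INR n) + 1.
Proof.
rewrite /xlnx; elim: n => // -[_ _|n IH _].
  by rewrite /= ln_1; lra.
have [l u] := IH isT; have [s t] := @ln_succ_bounds n.+1 isT.
rewrite factS mult_INR ln_mult; [|exact: INR_gt0|by apply: INR_gt0; exact: fact_gt0].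
move: s t l u; rewrite (S_INR n.+1); move: (ln (INR n.+1 + 1)) (ln (INR n.+1)) (ln _) => a b c.
nra.
Qed.

(* With [z = y / m], the main terms of [ln y!] and [m * ln (y %/ m)!] are
   [y ln y - y] and [m (z ln z - z) = y ln y - y ln m - y]. *)
Lemma ln_fact_block m y : (0 < m <= y)%N ->
  Rabs (ln (INR y`!) - INR m * ln (INR (y %/ m)`!) - INR y * ln (INR m))
    <= INR m.+1 * (ln (INR y) + 1).
Proof.
move=> /andP[m0 my]; have y0 := leq_trans m0 my.
have M0 := INR_gt0 m0; have Y0 := INR_gt0 y0.
have M1 : 1 <= INR m by apply: (INR_leq (m := 1)).
set q := (y %/ m)%N; have q0 : (0 < q)%N by rewrite divn_gt0.
have Q1 : 1 <= INR q by apply: (INR_leq (m := 1)).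
pose z := INR y / INR m.
have qz : INR q <= z.
  apply: (Rmult_le_reg_r (INR m)) => //; rewrite /z /Rdiv Rmult_assoc Rinv_l; last lra.
  by rewrite Rmult_1_r -mult_INR; apply: INR_leq; exact: leq_divM.
have zq : z < INR q + 1.
  apply: (Rmult_lt_reg_r (INR m)) => //; rewrite /z /Rdiv Rmult_assoc Rinv_l; last lra.
  rewrite Rmult_1_r -S_INR -mult_INR; apply: lt_INR; apply/ltP.
  by have := ltnSn q; rewrite {1}/q ltn_divLR.
have lnz : ln z = ln (INR y) - ln (INR m).
  by rewrite /z /Rdiv ln_mult ?ln_Rinv //; exact: Rinv_0_lt_compat.
have [yl yu] := ln_fact_bounds y0; have [ql qu] := ln_fact_bounds q0.
have [sl su] := ln_succ_bounds q0.
have hq : xlnx (INR q) <= xlnx z by apply: xlnx_le.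
have hz : xlnx z <= xlnx (INR q.+1) by apply: xlnx_le; rewrite S_INR; lra.
have lqz : ln (INR q) <= ln z.
  by case: (Req_dec (INR q) z) => [->|?]; [lra | apply: Rlt_le; apply: ln_increasing; lra].
have lq : ln (INR q.+1) <= ln z + 1.
  have : ln (INR q.+1) - ln (INR q) <= 1 by move: su; nra.
  lra.
have lm : 0 <= ln (INR m) by exact: ln_INR_ge0.
have lz : 0 <= ln z by move: (ln_INR_ge0 q); lra.
(* As [q] may be close to [z - 1], [z] is compared with [q + 1] here, at the cost of [ln z + 1]. *)
have Tl : xlnx z - ln z - 1 <= ln (INR q`!).
  have : xlnx (INR q.+1) - ln (INR q.+1) <= ln (INR q`!).
    move: ql su; rewrite /xlnx S_INR; lra.
  lra.
have Tu : ln (INR q`!) <= xlnx z + ln z + 1 by lra.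
have mz : INR m * xlnx z = xlnx (INR y) - INR y * ln (INR m).
  by rewrite /xlnx lnz /z; field; lra.
have mTl := Rmult_le_compat_l _ _ _ (Rlt_le _ _ M0) Tl.
have mTu := Rmult_le_compat_l _ _ _ (Rlt_le _ _ M0) Tu.
have mlz : INR m * ln z <= INR m * ln (INR y) by apply: Rmult_le_compat_l; lra.
have ly := ln_INR_ge0 y.
by apply: Rabs_le; rewrite S_INR; move: mz; move: (xlnx z) Tl Tu mTl mTu {hq hz} => X; lra.
Qed.

(** * From inequalities between residues to inequalities for [psi] *)

Definition residue_sum (es : seq (nat * Z)) (j : nat) : Z :=
  foldr (fun x t => (x.2 * Z.of_nat (j %% x.1)%N + t)%Z) 0%Z es.

Definition step_sum (st : seq (Z * Z)) (j : Z) : Z :=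
  foldr (fun x t => if (x.1 <=? j)%Z then (x.2 + t)%Z else t) 0%Z st.

Definition dominated es st :=
  forall j, (0 < j)%N -> (residue_sum es j <= step_sum st (Z.of_nat j))%Z.

(** For [k <= y] the domination is applied at [j = y %/ k]; its condition [i <= j] is equivalent to
    [k <= y %/ i], which turns each step into a value of [psi]. For [k > y] both sides vanish. *)
Lemma dominated_psi es st Y y : dominated es st ->
  all (fun x => 0 < x.1)%N es -> all (fun x => 0 <? x.1)%Z st -> (y <= Y)%N ->
  rsum es (fun x => IZR x.2 * (ln (INR y`!) - INR x.1 * ln (INR (y %/ x.1)`!)))
    <= rsum st (fun x => IZR x.2 * psi Y (y %/ Z.to_nat x.1)).
Proof.
move=> dom es0 st0 yY.
have -> : rsum es (fun x => IZR x.2 * (ln (INR y`!) - INR x.1 * ln (INR (y %/ x.1)`!)))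
    = psum Y (fun k => IZR (residue_sum es (y %/ k))).
  transitivity (rsum es (fun x => psum Y (fun k =>
      IZR x.2 * INR ((y %/ k) %% x.1)%N))).
    apply: eq_rsum => x; rewrite psumM; congr (_ * _).
    rewrite (ln_fact_psum yY) (@ln_fact_psum Y) ?(leq_trans (leq_div _ _)) //.
    have -> : forall a b, a - INR x.1 * b = a + (- INR x.1) * b by move=> *; lra.
    rewrite -psumM -psumD; apply: eq_psum => k _.
    rewrite -divnMA mulnC divnMA {1}(divn_eq (y %/ k) x.1) plus_INR mult_INR; lra.
  rewrite -psum_rsum; apply: eq_psum => k _; elim: es {dom es0} => //= x es ->.
  by rewrite plus_IZR mult_IZR INR_IZR_INZ.
have -> : rsum st (fun x => IZR x.2 * psi Y (y %/ Z.to_nat x.1))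
    = psum Y (fun k => rsum st (fun x => IZR x.2 * INR (k <= y %/ Z.to_nat x.1)%N)).
  by rewrite psum_rsum; apply: eq_rsum => x; rewrite psumM.
apply: psum_le => k k0; have [yk|ky] := ltnP y k.
  rewrite (divn_small yk).
  have -> : residue_sum es 0 = 0%Z.
    by elim: es {dom es0} => //= x es ->; rewrite mod0n; lia.
  rewrite -(rsum0 st); apply: rsum_le => x.
  rewrite leqNgt (leq_ltn_trans (leq_div _ _) yk) /=; lra.
apply: (Rle_trans _ (IZR (step_sum st (Z.of_nat (y %/ k))))).
  by apply: IZR_le; apply: dom; rewrite divn_gt0.
apply: Req_le; elim: st st0 {dom} => //= x st IH /andP[/Z.ltb_spec0 x0 st0].
rewrite -(IH st0) leq_divRL; last by apply/ltP; lia.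
rewrite mulnC -leq_divRL //.
have -> : (x.1 <=? Z.of_nat (y %/ k))%Z = (Z.to_nat x.1 <= y %/ k)%N.
  by apply/idP/idP => [/Z.leb_spec0|/leP] h; [apply/leP|apply/Z.leb_spec0]; lia.
by case: leq; rewrite ?plus_IZR /=; lra.
Qed.

Definition log_weight (es : seq (nat * Z)) : R :=
  rsum es (fun x => IZR x.2 * ln (INR x.1)).
Definition err_weight (es : seq (nat * Z)) : Z :=
  foldr (fun x t => (Z.abs x.2 * (Z.of_nat x.1 + 1) + t)%Z) 0%Z es.
Definition abs_weight (st : seq (Z * Z)) : Z :=
  foldr (fun x t => (Z.abs x.2 + t)%Z) 0%Z st.
(** An upper bound for the slope of the sum of [w * psi (y / i)]: positive weights use the upper
    slope [B], negative ones the lower slope [A]. *)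
Definition cost (A B : R) (st : seq (Z * Z)) : R :=
  rsum st (fun x => if (0 <? x.2)%Z then IZR x.2 * B / IZR x.1 else IZR x.2 * A / IZR x.1).

Lemma log_weight_psi es st Y y : dominated es st ->
  all (fun x => 0 < x.1 <= y)%N es -> all (fun x => 0 <? x.1)%Z st -> (y <= Y)%N ->
  INR y * log_weight es - IZR (err_weight es) * (ln (INR y) + 1)
    <= rsum st (fun x => IZR x.2 * psi Y (y %/ Z.to_nat x.1)).
Proof.
move=> dom es0 st0 yY.
apply: Rle_trans (dominated_psi dom _ st0 yY); last first.
  by apply: sub_all es0 => x /andP[].
elim: es es0 {dom} => [|x es IH] /=; first by rewrite /log_weight /=; lra.
move=> /andP[xy /IH {}IH]; rewrite plus_IZR mult_IZR plus_IZR abs_IZR -INR_IZR_INZ.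
have := ln_fact_block xy; rewrite S_INR; move: IH; rewrite /log_weight /=.
move: (rsum _ _) (rsum _ _) (ln (INR y`!) - _) => u v b.
move: (INR x.1 + 1) (IZR x.2) (IZR _) (ln _ + 1) => m a e l IH.
have -> : INR y * (a * ln (INR x.1) + v) = INR y * v + a * (INR y * ln (INR x.1)) by lra.
move: (INR y * ln _) => c H.
have : a * (c - b) <= Rabs a * (m * l).
  apply: Rle_trans (Rle_abs _) _; rewrite Rabs_mult.
  by apply: Rmult_le_compat_l; [exact: Rabs_pos | rewrite Rabs_minus_sym].
lra.
Qed.

Definition psi_bounds Y A B C :=
  forall z, (z <= Y)%N -> A * INR z - C <= psi Y z <= B * INR z + C.

Lemma psi_ge0 Y z : 0 <= psi Y z.
Proof.
apply: Rle_trans (@psum_le Y (fun=> 0 * 0) _ _); first by rewrite psumM; lra.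
by move=> k _; have := pos_INR (k <= z)%N; lra.
Qed.

(** Each unit of weight costs the error [C]; the further [A] pays for the floor in [y %/ i] when the
    lower bound of [psi] is used. *)
Lemma steps_le Y A B C st y : 0 <= A -> 0 <= B -> psi_bounds Y A B C ->
  all (fun x => 0 <? x.1)%Z st -> (y <= Y)%N ->
  rsum st (fun x => IZR x.2 * psi Y (y %/ Z.to_nat x.1))
    <= INR y * cost A B st + IZR (abs_weight st) * (C + A).
Proof.
move=> A0 B0 bnd st0 yY; elim: st st0 => [|[i w] st IH] /=; first by rewrite /cost /=; lra.
move=> /andP[/Z.ltb_spec0 i0 /IH {}IH]; rewrite plus_IZR abs_IZR.
have [l u] := bnd (y %/ Z.to_nat i)%N (leq_trans (leq_div _ _) yY).
set q := (y %/ _)%N in l u *.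
have I0 : 0 < IZR i by apply: (IZR_lt 0).
have qi : INR (Z.to_nat i) = IZR i by rewrite INR_IZR_INZ Z2Nat.id //; lia.
have n0 : (0 < Z.to_nat i)%N by apply/ltP; lia.
have q1 : INR q <= INR y / IZR i.
  apply: (Rmult_le_reg_r (IZR i)) => //; rewrite /Rdiv Rmult_assoc Rinv_l; last lra.
  by rewrite Rmult_1_r -qi -mult_INR; apply: INR_leq; exact: leq_divM.
have q2 : INR y / IZR i - 1 <= INR q.
  suff : INR y / IZR i <= INR q + 1 by lra.
  apply: (Rmult_le_reg_r (IZR i)) => //; rewrite /Rdiv Rmult_assoc Rinv_l; last lra.
  rewrite Rmult_1_r -qi -S_INR -mult_INR; apply: INR_leq.
  by have := ltnSn q; rewrite {1}/q ltn_divLR // => /ltnW.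
have Aq := Rmult_le_compat_l _ _ _ A0 q2.
have Bq := Rmult_le_compat_l _ _ _ B0 q1.
move: IH; rewrite /cost /=; move: (rsum _ _) (rsum _ _) (IZR (abs_weight st)) => s t v IH.
suff : IZR w * psi Y q <= INR y * (if (0 <? w)%Z then IZR w * B / IZR i else IZR w * A / IZR i)
    + Rabs (IZR w) * (C + A) by lra.
case: Z.ltb_spec0 => w0.
- have W0 : 0 < IZR w by apply: (IZR_lt 0).
  rewrite Rabs_pos_eq; last lra.
  have -> : INR y * (IZR w * B / IZR i) = IZR w * (B * (INR y / IZR i)) by rewrite /Rdiv; ring.
  by rewrite -Rmult_plus_distr_l; apply: Rmult_le_compat_l; lra.
- have W0 : IZR w <= 0 by apply: (IZR_le _ 0); lia.
  rewrite Rabs_left1 //.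
  have -> : INR y * (IZR w * A / IZR i) = IZR w * (A * (INR y / IZR i)) by rewrite /Rdiv; ring.
  have : - IZR w * (A * (INR y / IZR i - 1) - C) <= - IZR w * psi Y q.
    by apply: Rmult_le_compat_l; lra.
  lra.
Qed.

(** * Numerical bounds for logarithms *)

Lemma le_of_derive_ge0 (f f' : R -> R) (a b : R) : a <= b ->
  (forall c, a <= c <= b -> derivable_pt_lim f c (f' c)) ->
  (forall c, a <= c <= b -> 0 <= f' c) -> f a <= f b.
Proof.
move=> ab df f0; case: (Req_dec a b) => [->|nab]; first lra.
have [|c [fab cab]] := @MVT_cor2 f f' a b _ df; first lra.
have : 0 <= f' c * (b - a) by apply: Rmult_le_pos; [apply: f0|]; lra.
lra.
Qed.

(** The difference vanishes at [1] and has derivative [(t - 1)^2 / (t (t + 1)^2)]. *)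
Lemma ln_ge_pade t : 1 <= t -> 2 * (t - 1) / (t + 1) <= ln t.
Proof.
move=> t1.
suff : ln 1 - 2 * (1 - 1) / (1 + 1) <= ln t - 2 * (t - 1) / (t + 1) by rewrite ln_1; lra.
apply: (@le_of_derive_ge0 (fun t => ln t - 2 * (t - 1) / (t + 1))
  (fun t => / t - (2 * (t + 1) - 1 * (2 * (t - 1))) / Rsqr (t + 1))) => // c c1.
- apply: derivable_pt_lim_minus; first by apply: derivable_pt_lim_ln; lra.
  apply: (derivable_pt_lim_div (fun t => 2 * (t - 1)) (fun t => t + 1)); last lra.
  + have {2}-> : 2 = 2 * (1 - 0) by lra.
    apply: derivable_pt_lim_scal; apply: derivable_pt_lim_minus;
      [exact: derivable_pt_lim_id | exact: derivable_pt_lim_const].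
  + have {2}-> : 1 = 1 + 0 by lra.
    by apply: derivable_pt_lim_plus;
      [exact: derivable_pt_lim_id | exact: derivable_pt_lim_const].
- have -> : / c - (2 * (c + 1) - 1 * (2 * (c - 1))) / Rsqr (c + 1)
      = Rsqr (c - 1) * / (c * Rsqr (c + 1)) by rewrite /Rsqr; field; lra.
  apply: Rmult_le_pos; first exact: Rle_0_sqr.
  apply: Rlt_le; apply: Rinv_0_lt_compat; apply: Rmult_lt_0_compat; first lra.
  by apply: Rlt_0_sqr; lra.
Qed.

(** The difference vanishes at [1] and has derivative [(t - 1)^2 / (2 t^2)]. *)
Lemma ln_le_pade t : 1 <= t -> ln t <= (t * t - 1) / (2 * t).
Proof.
move=> t1.
suff : (1 * 1 - 1) / (2 * 1) - ln 1 <= (t * t - 1) / (2 * t) - ln t by rewrite ln_1; lra.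
apply: (@le_of_derive_ge0 (fun t => (t * t - 1) / (2 * t) - ln t)
  (fun t => (2 * t * (2 * t) - 2 * (t * t - 1)) / Rsqr (2 * t) - / t)) => // c c1.
- apply: derivable_pt_lim_minus; last by apply: derivable_pt_lim_ln; lra.
  apply: (derivable_pt_lim_div (fun t => t * t - 1) (fun t => 2 * t)); last lra.
  + have -> : 2 * c = 1 * c + c * 1 - 0 by lra.
    apply: derivable_pt_lim_minus; last exact: derivable_pt_lim_const.
    by apply: (derivable_pt_lim_mult (fun t => t) (fun t => t)); exact: derivable_pt_lim_id.
  + have {2}-> : 2 = 2 * 1 by lra.
    by apply: derivable_pt_lim_scal; exact: derivable_pt_lim_id.
- have -> : (2 * c * (2 * c) - 2 * (c * c - 1)) / Rsqr (2 * c) - / c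
      = Rsqr (c - 1) * / (2 * Rsqr c) by rewrite /Rsqr; field; lra.
  apply: Rmult_le_pos; first exact: Rle_0_sqr.
  apply: Rlt_le; apply: Rinv_0_lt_compat; apply: Rmult_lt_0_compat; first lra.
  by apply: Rlt_0_sqr; lra.
Qed.

(** Both rational bounds are taken at [t = (n + 1) / n]. The bracket has width
    [1 / (2 n (n + 1) (2 n + 1))], so moderate [n] already give good precision. *)
Lemma ln_succ_pade n : (0 < n)%Z ->
  2 / IZR (2 * n + 1) <= ln (IZR (n + 1)) - ln (IZR n)
    <= IZR (2 * n + 1) / IZR (2 * n * (n + 1)).
Proof.
move=> n0; have N0 : 0 < IZR n by apply: (IZR_lt 0).
have t1 : 1 <= (IZR n + 1) / IZR n.
  have -> : (IZR n + 1) / IZR n = 1 + / IZR n by field; lra.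
  by have := Rinv_0_lt_compat _ N0; lra.
have lt : ln ((IZR n + 1) / IZR n) = ln (IZR n + 1) - ln (IZR n).
  by rewrite /Rdiv ln_mult ?ln_Rinv //; try lra; exact: Rinv_0_lt_compat.
have := ln_ge_pade t1; have := ln_le_pade t1.
rewrite lt !(plus_IZR, mult_IZR) => u l; split.
- by apply: Rle_trans l; apply: Req_le; field; lra.
- by apply: Rle_trans u _; apply: Req_le; field; lra.
Qed.

Definition zprod : seq Z -> Z := foldr Z.mul 1%Z.

Fixpoint zfactor (fuel : nat) (d n : Z) : seq Z :=
  if fuel is fuel'.+1 then
    if (n <=? 1)%Z then [::]
    else if (n mod d =? 0)%Z then d :: zfactor fuel' d (n / d) else zfactor fuel' (d + 1) n
  else [:: n].

Arguments zfactor : simpl never.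

Lemma ln_zprod s : all (Z.ltb 0) s -> ln (IZR (zprod s)) = rsum s (fun q => ln (IZR q)).
Proof.
elim: s => [|q s IH] /=; first by rewrite ln_1.
move=> /andP[/Z.ltb_spec0 q0 s0]; rewrite mult_IZR ln_mult ?IH //; apply: (IZR_lt 0) => //.
by elim: s s0 {IH} => //= r s IH /andP[/Z.ltb_spec0 r0 /IH]; lia.
Qed.

(** The output of [zfactor] is certified by multiplying it out. *)
Lemma ln_zfactor n s : zfactor 1000 2 n = s ->
  (zprod s =? n)%Z && all (Z.ltb 0) s -> ln (IZR n) = rsum s (fun q => ln (IZR q)).
Proof. by move=> _ /andP[/Z.eqb_spec <-]; exact: ln_zprod. Qed.

Ltac factor_ln n :=
  let s := eval vm_compute in (zfactor 1000 2 n) in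
  let H := fresh "H" in
  have H := @ln_zfactor n s (erefl _) (erefl _); cbn [rsum foldr] in H.

(** For smooth [n] and [n + 1] this yields linear inequalities between logarithms of small primes,
    which [lra] can combine. *)
Ltac succ_ln n :=
  let m := eval vm_compute in (n + 1)%Z in
  let H := fresh "H" in
  have H := @ln_succ_pade n (erefl _); cbn -[IZR] in H; factor_ln n; factor_ln m.

(* [(125, 126)], [(224, 225)], [(2400, 2401)] and [(4374, 4375)] are pairs of 7-smooth
   numbers, giving four independent relations. *)
Lemma ln_2357 :
  693141 / 1000000 <= ln 2 <= 693154 / 1000000 /\
  1098602 / 1000000 <= ln 3 <= 1098623 / 1000000 /\
  1609422 / 1000000 <= ln 5 <= 1609453 / 1000000 /\
  1945892 / 1000000 <= ln 7 <= 1945929 / 1000000.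
Proof.
succ_ln 125%Z; succ_ln 224%Z; succ_ln 2400%Z; succ_ln 4374%Z; lra.
Qed.

(** * Deciding domination by a scan over [j] *)

Local Open Scope nat_scope.

(* [(m.-1 - j %% m, m.-1, a * m)] for each [(m, a)]: the first component counts
   down to the next wrap-around of [j %% m]. *)
Definition counters_at (es : seq (nat * Z)) (j : nat) : seq (nat * nat * Z) :=
  [seq (x.1.-1 - j %% x.1, x.1.-1, (x.2 * Z.of_nat x.1)%Z) | x <- es].

Fixpoint tick (cs : seq (nat * nat * Z)) : seq (nat * nat * Z) * Z :=
  if cs is (c, m, b) :: cs' then
    let: (cs'', d) := tick cs' in
    if c is c'.+1 then ((c', m, b) :: cs'', d) else ((m, m, b) :: cs'', (d - b)%Z)
  else ([::], 0%Z).

Definition zsum (T : Type) (es : seq (T * Z)) : Z := foldr (fun x t => (x.2 + t)%Z) 0%Z es.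

(** From [j] to [j + 1] each residue grows by [1], and also drops by [m] if [m] divides [j + 1]. The
    total growth [zsum es] is the same at each step and is added by [scan]; [tick] returns the
    drops. *)
Lemma tickP es j : all (fun x => 1 < x.1) es ->
  tick (counters_at es j) =
  (counters_at es j.+1, (residue_sum es j.+1 - residue_sum es j - zsum es)%Z).
Proof.
elim: es => [|[m a] es IH] //= /andP[m1 /IH ->] {IH}.
have := @modn_pred j.+1 m; rewrite -pred_Sn => /(_ _ isT) jm.
have {}jm : j %% m = if m %| j.+1 then m.-1 else (j.+1 %% m).-1.
  by apply: jm; rewrite neq_ltn m1 orbT.
have ltm := ltn_pmod j.+1 (ltnW m1).
case: ifP jm => [dvd|/negbT ndvd] jm; rewrite jm.
  have em : Z.of_nat m = (Z.of_nat m.-1 + 1)%Z by case: (m) m1 => // k _; rewrite -pred_Sn; lia.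
  by rewrite subnn (eqP dvd) subn0; congr (_, _); rewrite em; lia.
have s0 : 0 < j.+1 %% m by rewrite lt0n.
case: (j.+1 %% m) s0 ltm => // x _ xm /=.
rewrite -(@subnSK x m.-1) 1?ltn_predRL //; congr (_, _); lia.
Qed.

Fixpoint scan (st : seq (Z * Z)) (a : Z) (fuel : nat) (j v : Z) (cs : seq (nat * nat * Z)) : bool :=
  if fuel is fuel'.+1 then
    let: (cs', d) := tick cs in
    let v' := (v + d + a)%Z in
    let j' := (j + 1)%Z in
    if (v' <=? step_sum st j')%Z then scan st a fuel' j' v' cs' else false
  else true.

Definition tail_bound (es : seq (nat * Z)) : Z :=
  foldr (fun x t => (Z.max 0 x.2 * (Z.of_nat x.1 - 1) + t)%Z) 0%Z es.

(** Beyond [fuel] every step is active, so the right side is the constant [zsum st], while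
    [tail_bound] majorises every residue sum. *)
Definition dominatedb (es : seq (nat * Z)) (st : seq (Z * Z)) (fuel : nat) : bool :=
  [&& all (fun x => 1 < x.1) es, all (fun x => x.1 <=? Z.of_nat fuel)%Z st,
      (tail_bound es <=? zsum st)%Z & scan st (zsum es) fuel 0 0 (counters_at es 0)].

Lemma scanP es st fuel j0 : all (fun x => 1 < x.1) es ->
  scan st (zsum es) fuel (Z.of_nat j0) (residue_sum es j0) (counters_at es j0) ->
  forall j, j0 < j <= j0 + fuel -> (residue_sum es j <= step_sum st (Z.of_nat j))%Z.
Proof.
move=> es1; elim: fuel j0 => [|fuel IH] j0 /=.
  by move=> _ j /andP[lj jl]; move: (leq_trans lj jl); rewrite addn0 ltnn.
rewrite (tickP _ es1).
have -> : (Z.of_nat j0 + 1)%Z = Z.of_nat j0.+1 by lia.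
have -> : (residue_sum es j0 + (residue_sum es j0.+1 - residue_sum es j0 - zsum es)
  + zsum es)%Z = residue_sum es j0.+1 by lia.
case: Z.leb_spec0 => // le /IH {}IH j jj.
have [->//|ne] := eqVneq j j0.+1; apply: IH.
by rewrite addSnnS ltn_neqAle eq_sym ne.
Qed.

Lemma residue_sum0 es : residue_sum es 0 = 0%Z.
Proof. by elim: es => //= x es ->; rewrite mod0n; lia. Qed.

Lemma step_sum_ge st (k j : nat) : all (fun x => x.1 <=? Z.of_nat k)%Z st -> k <= j ->
  step_sum st (Z.of_nat j) = zsum st.
Proof.
move=> + /leP kj; elim: st => //= x st IH /andP[/Z.leb_spec0 xk /IH ->].
by case: Z.leb_spec0 => //; lia.
Qed.

Lemma dominatedP es st fuel : dominatedb es st fuel -> dominated es st.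
Proof.
move=> /and4P[es1 stf tl sc] j j0.
have [jf|fj] := leqP j fuel.
  by move: sc; rewrite -{2}(residue_sum0 es) => /(scanP (j0 := 0) es1); apply; rewrite j0.
rewrite (step_sum_ge stf (ltnW fj)).
apply: Z.le_trans (_ : (tail_bound es <= zsum st)%Z); last exact/Z.leb_spec0.
elim: es es1 {tl sc} => //= [[m a] es] IH /= /andP[m1 /IH {}IH].
have := ltn_pmod j (ltnW m1); move: (j %% m) => r /ltP rm.
have : (a * Z.of_nat r <= Z.max 0 a * (Z.of_nat m - 1))%Z by nia.
lia.
Qed.

(** For Chebyshev's weights [tail_bound] is too large, but residue sums have period [P]. Two periods
    are scanned because [j > 2 P] is compared with [P + j mod P], where all steps are already
    active. *)
Definition dominatedb_periodic (es : seq (nat * Z)) (st : seq (Z * Z)) (P : nat) : bool :=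
  [&& all (fun x => (1 < x.1) && (x.1 %| P)) es, all (fun x => x.1 <=? Z.of_nat P)%Z st &
      scan st (zsum es) (P + P) 0 0 (counters_at es 0)].

Lemma dominated_periodicP es st P : 0 < P -> dominatedb_periodic es st P -> dominated es st.
Proof.
move=> P0 /and3P[es1 stP sc] j j0.
have m1 : all (fun x => 1 < x.1) es by apply: sub_all es1 => x /andP[].
have {}sc : forall i, 0 < i <= P + P -> (residue_sum es i <= step_sum st (Z.of_nat i))%Z.
  by move: sc; rewrite -{2}(residue_sum0 es) => /(scanP (j0 := 0) m1).
have [jP|Pj] := leqP j (P + P); first by apply: sc; rewrite j0.
have le : P <= P + j %% P <= P + P by rewrite leq_addr leq_add2l ltnW // ltn_pmod.
have := sc (P + j %% P); rewrite (leq_trans P0) ?leq_addr //=.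
case/andP: le => le1 le2; rewrite le2 => /(_ isT).
rewrite !(step_sum_ge stP) //; last by rewrite (leq_trans _ (ltnW Pj)) // leq_addr.
suff -> : residue_sum es (P + j %% P) = residue_sum es j by [].
elim: es es1 {m1 sc} => //= [[m a] es] IH /= /andP[/andP[_ mP] /IH ->].
by rewrite -modnDml (eqP mP) add0n modn_dvdm.
Qed.

Local Open Scope R_scope.

(** * Improving bounds for [psi] *)

Lemma ln_le_tangent c y : 0 < c -> 0 < y -> ln y <= y / c + ln c - 1.
Proof.
move=> c0 y0; have ic := Rinv_0_lt_compat _ c0.
have : 0 < y / c by apply: Rmult_lt_0_compat.
move=> /ln_le_sub1; rewrite /Rdiv ln_mult ?ln_Rinv //; lra.
Qed.

Lemma weighted_psi Y A B C es w st y : 0 <= A -> 0 <= B -> psi_bounds Y A B C ->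
  dominated es ((1%Z, w) :: st) ->
  all (fun x => 0 < x.1 <= 100)%N es -> all (fun x => 0 <? x.1)%Z st ->
  (100 <= y <= Y)%N ->
  INR y * (log_weight es - cost A B st - IZR (err_weight es) / 1000000)
    - (IZR (err_weight es) * 14 + IZR (abs_weight st) * (C + A)) <= IZR w * psi Y y.
Proof.
move=> A0 B0 bnd dom es1 st1 /andP[y100 yY].
have := @log_weight_psi _ _ Y y dom _ _ yY.
rewrite [rsum ((1%Z, w) :: st) _]/= divn1.
have := steps_le A0 B0 bnd st1 yY.
have Y0 : 0 < INR y by apply: INR_gt0; exact: leq_trans y100.
(* The tangent at [10^6], where [ln (10^6) - 1 < 13], splits the logarithmic error into a tiny slope
   and a constant. *)
have : ln (INR y) <= INR y / 1000000 + 13.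
  have [[_ l2] [_ [[_ l5] _]]] := ln_2357.
  have := @ln_le_tangent 1000000 (INR y); factor_ln 1000000%Z; lra.
have : 0 <= IZR (err_weight es) by apply: (IZR_le 0); elim: (es) => //= x s; lia.
move: (IZR (err_weight es)) (rsum _ _) (ln (INR y)) => e r l e0 ly rle h.
have {}h : INR y * log_weight es - e * (l + 1) <= IZR w * psi Y y + r.
  by apply: h => //=; apply: sub_all es1 => x /andP[-> x1]; exact: leq_trans y100.
have : e * (l + 1) <= e * (INR y / 1000000 + 14) by apply: Rmult_le_compat_l; lra.
lra.
Qed.

(** For [y >= 100], so that no modulus in the tables exceeds [y], the two weighted inequalities are
    divided by [wl] and [wu]. For [y < 100] the last two hypotheses make the new bounds weaker than
    [0 <= psi] and the old upper bound. *)
Lemma psi_bounds_step Y A B C el wl sl eu wu su A' B' C' :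
  0 <= A -> 0 <= B -> psi_bounds Y A B C ->
  dominated el ((1%Z, wl) :: sl) -> dominated eu ((1%Z, (- wu)%Z) :: su) ->
  all (fun x => 0 < x.1 <= 100)%N (el ++ eu) -> all (fun x => 0 <? x.1)%Z (sl ++ su) ->
  (0 < wl)%Z -> (0 < wu)%Z ->
  IZR wl * A' + cost A B sl + IZR (err_weight el) / 1000000 <= log_weight el ->
  cost A B su + IZR (err_weight eu) / 1000000 - IZR wu * B' <= log_weight eu ->
  IZR (err_weight el) * 14 + IZR (abs_weight sl) * (C + A) <= IZR wl * C' ->
  IZR (err_weight eu) * 14 + IZR (abs_weight su) * (C + A) <= IZR wu * C' ->
  0 <= A' -> B' <= B -> 100 * A' <= C' -> 100 * (B - B') + C <= C' ->
  psi_bounds Y A' B' C'.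
Proof.
move=> A0 B0 bnd dl du; rewrite !all_cat => /andP[el1 eu1] /andP[sl1 su1].
move=> /(IZR_lt 0) wl0 /(IZR_lt 0) wu0 hl hu cl cu A'0 BB' c1 c2 y yY.
have y0 := pos_INR y.
have [y100|y100] := leqP 100 y; last first.
  have {}y100 : INR y <= 100 by rewrite -[100](INR_IZR_INZ 100); apply: INR_leq; exact: ltnW.
  have := psi_ge0 Y y; have [_ u] := bnd _ yY.
  have : A' * INR y <= A' * 100 by exact: Rmult_le_compat_l.
  have : (B - B') * INR y <= (B - B') * 100 by apply: Rmult_le_compat_l; lra.
  by lra.
have yr : (100 <= y <= Y)%N by rewrite y100.
have l := weighted_psi A0 B0 bnd dl el1 sl1 yr.
have u := weighted_psi A0 B0 bnd du eu1 su1 yr.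
split.
- apply: (Rmult_le_reg_l (IZR wl)) => //; apply: Rle_trans l.
  have : INR y * (IZR wl * A') <= INR y * (log_weight el - cost A B sl - IZR (err_weight el) / 1000000).
    by apply: Rmult_le_compat_l => //; lra.
  lra.
- apply: (Rmult_le_reg_l (IZR wu)) => //.
  have : INR y * (- (IZR wu * B'))
      <= INR y * (log_weight eu - cost A B su - IZR (err_weight eu) / 1000000).
    by apply: Rmult_le_compat_l => //; lra.
  move: u; rewrite opp_IZR; lra.
Qed.

Lemma psi_le_ln_fact Y y : (y <= Y)%N -> psi Y y <= ln (INR y`!).
Proof.
move=> yY; rewrite (ln_fact_psum yY); apply: psum_le => k k0; apply: INR_leq.
by case ky : (k <= y)%N; rewrite //= divn_gt0 // ky.
Qed.

Lemma Rabs_le_between x c : Rabs x <= c -> - c <= x <= c.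
Proof. by have := Rle_abs x; have := Rle_abs (- x); rewrite Rabs_Ropp; lra. Qed.

Lemma psi_bounds_base Y : psi_bounds Y 0 2 100.
Proof.
have [[_ l2] _] := ln_2357.
(* This encodes the classical [psi y - psi (y / 2) <= ln y! - 2 ln (y / 2)!]. *)
have dom : dominated [:: (2%N, (-1)%Z)] [:: (1, -1)%Z; (2, 1)%Z] by apply: (@dominatedP _ _ 2).
elim/ltn_ind => y IH yY; split; first by have := psi_ge0 Y y; lra.
have y0 := pos_INR y.
(* From 49 on, the error [3 (ln y + 1)] fits into the slack [(1 - ln 2) y] of the induction. *)
have [y50|y50] := ltnP y 49.
  apply: Rle_trans (psi_le_ln_fact yY) _.
  have [->|yp] := posnP y; first by rewrite ln_1 /=; lra.
  apply: Rle_trans (proj2 (ln_fact_bounds yp)) _.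
  have yy : INR y <= 49 by rewrite -[49](INR_IZR_INZ 49); apply: INR_leq; exact: ltnW.
  have ly : ln (INR y) <= INR y / 16 + 18 / 10.
    have := @ln_le_tangent 16 (INR y); have := INR_gt0 yp; factor_ln 16%Z; lra.
  have : INR y * ln (INR y) <= INR y * (INR y / 16 + 18 / 10) by exact: Rmult_le_compat_l.
  rewrite /xlnx; nra.
have y2 : (0 < 2 <= y)%N by rewrite (leq_trans _ y50).
have Y50 : 49 <= INR y by rewrite -[49](INR_IZR_INZ 49); exact: INR_leq.
have := dominated_psi dom isT isT yY; rewrite /= divn1.
have [_ hi] := Rabs_le_between (ln_fact_block y2).
move: hi; rewrite (INR_IZR_INZ 2) (INR_IZR_INZ 3) => hi.
have half : (y %/ 2 < y)%N by rewrite ltn_Pdiv // (leq_trans _ y50).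
have [_ u] := IH _ half (leq_trans (ltnW half) yY).
have : INR (y %/ 2) <= INR y / 2.
  by have := INR_leq (leq_divM y 2); rewrite mult_INR /=; lra.
have ly : ln (INR y) <= INR y / 32 + 247 / 100.
  have := @ln_le_tangent 32 (INR y); factor_ln 32%Z; lra.
have : INR y * ln 2 <= INR y * (693154 / 1000000) by apply: Rmult_le_compat_l; lra.
move: u hi; rewrite /Pos.to_nat /=; lra.
Qed.

(** * The weights *)

Local Open Scope Z_scope.

(* From Chebyshev's quotient [y! (y/30)! / ((y/2)! (y/3)! (y/5)!)], scaled by 30. *)
Definition chebyshev_table : seq (nat * Z) :=
  [:: (2%N, 15); (3%N, 10); (5%N, 6); (30%N, -1)].
Definition chebyshev_table_opp : seq (nat * Z) :=
  [:: (2%N, -15); (3%N, -10); (5%N, -6); (30%N, 1)].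

(* Solutions of the linear programs that optimise the resulting bounds, times 10^4 and
   rounded; for small [m] the weight of [m] is [- mu(m) / m].  The last step, at 8000,
   absorbs the crude bound [tail_bound]. *)
Definition lower_table : seq (nat * Z) :=
  [:: (2%N, 5000); (3%N, 3333); (5%N, 2000); (6%N, (-1667)); (7%N, 1429); (10%N, (-1000));
   (11%N, 889); (13%N, 769); (14%N, (-714)); (15%N, (-667)); (16%N, 1); (17%N, 426);
   (19%N, 526); (21%N, (-476)); (22%N, (-214)); (23%N, 214); (26%N, (-385)); (28%N, 190);
   (29%N, 130); (30%N, 333); (31%N, 323); (33%N, (-296)); (34%N, (-213)); (35%N, (-122));
   (36%N, 98); (37%N, 21); (38%N, (-178)); (39%N, (-161)); (41%N, 62); (42%N, 238); (43%N,
   233); (44%N, (-115)); (45%N, 124); (46%N, (-33)); (47%N, 21); (51%N, (-74)); (52%N,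
   40); (53%N, 84); (55%N, (-70)); (56%N, 48); (57%N, (-57)); (58%N, (-108)); (59%N, 17);
   (60%N, 12); (61%N, 1); (62%N, (-161)); (65%N, (-33)); (66%N, 104); (69%N, 14); (71%N,
   16); (73%N, 89); (74%N, (-10)); (77%N, 16); (79%N, 26); (80%N, 9); (83%N, 81); (84%N,
   (-63)); (85%N, (-47)); (86%N, (-116)); (87%N, (-2)); (88%N, 24); (89%N, 11); (90%N,
   (-62)); (93%N, 13); (95%N, (-14)); (96%N, 47); (98%N, 32); (99%N, 16)].

Definition lower_steps : seq (Z * Z) :=
  [:: (11, 236); (17, 2793); (29, 927); (41, 541); (71, 7191); (109, 4487); (115, -2378);
   (193, 102); (199, 6315); (600, 554); (1000, 5176); (8000, 142176)].

(* Signs are flipped, so that the upper bound is again a [dominated] inequality. *)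
Definition upper_table : seq (nat * Z) :=
  [:: (2%N, (-5000)); (3%N, (-3333)); (5%N, (-2000)); (6%N, 1667); (7%N, (-1429)); (10%N,
   1000); (11%N, (-909)); (13%N, (-683)); (14%N, 686); (15%N, 667); (17%N, (-588)); (19%N,
   (-499)); (21%N, 457); (22%N, 455); (23%N, (-384)); (24%N, (-48)); (26%N, 341); (28%N,
   14); (29%N, (-215)); (30%N, (-459)); (31%N, (-51)); (33%N, 97); (34%N, 200); (35%N,
   77); (37%N, (-140)); (38%N, 123); (39%N, 228); (41%N, (-244)); (42%N, (-219)); (43%N,
   (-111)); (44%N, (-22)); (45%N, (-47)); (46%N, 146); (47%N, (-39)); (50%N, 43); (51%N,
   17); (53%N, (-45)); (55%N, 68); (56%N, (-50)); (57%N, 73); (58%N, 105); (59%N, (-84));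
   (60%N, (-21)); (62%N, (-16)); (65%N, 28); (66%N, (-49)); (67%N, (-19)); (69%N, 48);
   (70%N, (-33)); (71%N, (-43)); (74%N, 70); (75%N, (-33)); (77%N, 20); (78%N, (-114));
   (79%N, (-7)); (82%N, 37); (85%N, 45); (86%N, 23); (87%N, 28); (88%N, 11); (90%N, 45);
   (92%N, 19); (93%N, 17); (94%N, 47); (95%N, 72); (96%N, 12); (97%N, (-28)); (100%N,
   (-22))].

Definition upper_steps : seq (Z * Z) :=
  [:: (13, -719); (19, -109); (34, 1583); (35, 7309); (56, 1393); (57, 5321); (58, 206);
   (91, 582); (92, 453); (161, 287); (200, 4019); (300, 2041); (600, 1364); (1000, 3115);
   (1600, 1026); (8000, 137468)].

Lemma chebyshev_dominated : dominated chebyshev_table [:: (1, 30)].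
Proof. by apply: (@dominated_periodicP _ _ 30) => //; vm_cast_no_check (erefl true). Qed.

Lemma chebyshev_opp_dominated : dominated chebyshev_table_opp [:: (1, -30); (6, 30)].
Proof. by apply: (@dominated_periodicP _ _ 30) => //; vm_cast_no_check (erefl true). Qed.

Lemma lower_dominated : dominated lower_table ((1, 10022) :: lower_steps).
Proof. apply: (@dominatedP _ _ (Z.to_nat 8000)). vm_cast_no_check (erefl true). Qed.

Lemma upper_dominated : dominated upper_table ((1, -9981) :: upper_steps).
Proof. apply: (@dominatedP _ _ (Z.to_nat 8000)). vm_cast_no_check (erefl true). Qed.

(** * Evaluation of the main terms *)

Local Open Scope R_scope.

Definition ln_table : seq (Z * (Z * Z)) :=
  [:: (2, (693141, 693154)); (3, (1098602, 1098623)); (5, (1609422, 1609453)); (7,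
   (1945892, 1945929)); (11, (2397872, 2397919)); (13, (2564925, 2564975)); (17, (2833187,
   2833242)); (19, (2944411, 2944468)); (23, (3135465, 3135526)); (29, (3367264,
   3367329)); (31, (3433955, 3434021)); (37, (3610884, 3610954)); (41, (3713537,
   3713609)); (43, (3761164, 3761237)); (47, (3850112, 3850186)); (53, (3970255,
   3970332)); (59, (4077499, 4077578)); (61, (4110835, 4110914)); (67, (4204653,
   4204735)); (71, (4262640, 4262722)); (73, (4290419, 4290502)); (79, (4369407,
   4369491)); (83, (4418799, 4418885)); (89, (4488594, 4488681)); (97, (4574669,
   4574756))]%Z.

Definition ln_bracket (x : Z * (Z * Z)) : Prop :=
  IZR x.2.1 <= 1000000 * ln (IZR x.1) <= IZR x.2.2.

Fixpoint lookup (q : Z) (T : seq (Z * (Z * Z))) : option (Z * Z) :=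
  if T is x :: T' then if (x.1 =? q)%Z then Some x.2 else lookup q T' else None.

Fixpoint factor_bracket (T : seq (Z * (Z * Z))) (s : seq Z) : option (Z * Z) :=
  if s is q :: s' then
    if (lookup q T, factor_bracket T s') is (Some (l, u), Some (l', u'))
    then Some (l + l', u + u')%Z else None
  else Some (0, 0)%Z.

Fixpoint log_weight_low (T : seq (Z * (Z * Z))) (es : seq (nat * Z)) : option Z :=
  if es is (m, a) :: es' then
    let s := zfactor 1000 2 (Z.of_nat m) in
    if ((zprod s =? Z.of_nat m)%Z && all (Z.ltb 0) s, factor_bracket T s, log_weight_low T es')
      is (true, Some (l, u), Some v)
    then Some (a * (if (0 <=? a)%Z then l else u) + v)%Z else None
  else Some 0%Z.

Lemma lookupP q T l u : List.Forall ln_bracket T -> lookup q T = Some (l, u) ->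
  ln_bracket (q, (l, u)).
Proof.
elim=> //= -[p b] {}T pb _ IH /=; case: Z.eqb_spec => [<- [<-]|_] //; exact: IH.
Qed.

Lemma factor_bracketP T s l u : List.Forall ln_bracket T -> factor_bracket T s = Some (l, u) ->
  IZR l <= 1000000 * rsum s (fun q => ln (IZR q)) <= IZR u.
Proof.
move=> TP; elim: s l u => [|q s IH] l u /=; first by case=> <- <-; lra.
case eq: lookup => [[l1 u1]|//]; case: factor_bracket IH => [[l2 u2] IH|//] [<- <-].
have := lookupP TP eq; have := IH _ _ erefl; rewrite /ln_bracket /= !plus_IZR; lra.
Qed.

Lemma log_weight_lowP T es v : List.Forall ln_bracket T -> log_weight_low T es = Some v ->
  IZR v <= 1000000 * log_weight es.
Proof.
move=> TP; elim: es v => [|[m a] es IH] v; first by case=> <-; rewrite /log_weight /=; lra.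
rewrite [log_weight_low _ _]/=; case sm : (_ && _) => //.
case eq : factor_bracket => [[l u]|//]; case: log_weight_low IH => [v' IH|//] [<-].
have := factor_bracketP TP eq; rewrite -(ln_zfactor erefl sm) -INR_IZR_INZ => -[lm mu].
have := IH _ erefl; rewrite plus_IZR mult_IZR /log_weight /=.
suff : IZR a * IZR (if (0 <=? a)%Z then l else u) <= IZR a * (1000000 * ln (INR m)) by lra.
case: Z.leb_spec0 => a0; first by apply: Rmult_le_compat_l => //; apply: (IZR_le 0).
have : IZR a <= 0 by apply: (IZR_le _ 0); lia.
nra.
Qed.

(* Each further prime [p] from the pair [p^2 - 1, p^2]. *)
Lemma ln_tableP : List.Forall ln_bracket ln_table.
Proof.
have [l2 [l3 [l5 l7]]] := ln_2357.
have l11 : 2397872 / 1000000 <= ln 11 <= 2397919 / 1000000 by succ_ln 120%Z; lra.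
have l13 : 2564925 / 1000000 <= ln 13 <= 2564975 / 1000000 by succ_ln 168%Z; lra.
have l17 : 2833187 / 1000000 <= ln 17 <= 2833242 / 1000000 by succ_ln 288%Z; lra.
have l19 : 2944411 / 1000000 <= ln 19 <= 2944468 / 1000000 by succ_ln 360%Z; lra.
have l23 : 3135465 / 1000000 <= ln 23 <= 3135526 / 1000000 by succ_ln 528%Z; lra.
have l29 : 3367264 / 1000000 <= ln 29 <= 3367329 / 1000000 by succ_ln 840%Z; lra.
have l31 : 3433955 / 1000000 <= ln 31 <= 3434021 / 1000000 by succ_ln 960%Z; lra.
have l37 : 3610884 / 1000000 <= ln 37 <= 3610954 / 1000000 by succ_ln 1368%Z; lra.
have l41 : 3713537 / 1000000 <= ln 41 <= 3713609 / 1000000 by succ_ln 1680%Z; lra.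
have l43 : 3761164 / 1000000 <= ln 43 <= 3761237 / 1000000 by succ_ln 1848%Z; lra.
have l47 : 3850112 / 1000000 <= ln 47 <= 3850186 / 1000000 by succ_ln 2208%Z; lra.
have l53 : 3970255 / 1000000 <= ln 53 <= 3970332 / 1000000 by succ_ln 2808%Z; lra.
have l59 : 4077499 / 1000000 <= ln 59 <= 4077578 / 1000000 by succ_ln 3480%Z; lra.
have l61 : 4110835 / 1000000 <= ln 61 <= 4110914 / 1000000 by succ_ln 3720%Z; lra.
have l67 : 4204653 / 1000000 <= ln 67 <= 4204735 / 1000000 by succ_ln 4488%Z; lra.
have l71 : 4262640 / 1000000 <= ln 71 <= 4262722 / 1000000 by succ_ln 5040%Z; lra.
have l73 : 4290419 / 1000000 <= ln 73 <= 4290502 / 1000000 by succ_ln 5328%Z; lra.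
have l79 : 4369407 / 1000000 <= ln 79 <= 4369491 / 1000000 by succ_ln 6240%Z; lra.
have l83 : 4418799 / 1000000 <= ln 83 <= 4418885 / 1000000 by succ_ln 6888%Z; lra.
have l89 : 4488594 / 1000000 <= ln 89 <= 4488681 / 1000000 by succ_ln 7920%Z; lra.
have l97 : 4574669 / 1000000 <= ln 97 <= 4574756 / 1000000 by succ_ln 9408%Z; lra.
rewrite /ln_table /ln_bracket.
by do 25 (apply: List.Forall_cons; first by rewrite /=; lra).
Qed.

Lemma chebyshev_log_weight : IZR (27638437) <= 1000000 * log_weight chebyshev_table.
Proof. by apply: (log_weight_lowP ln_tableP); vm_cast_no_check (erefl (Some (27638437)%Z)). Qed.

Lemma chebyshev_opp_log_weight : IZR (-27639093) <= 1000000 * log_weight chebyshev_table_opp.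
Proof. by apply: (log_weight_lowP ln_tableP); vm_cast_no_check (erefl (Some (-27639093)%Z)). Qed.

Lemma lower_log_weight : IZR (10126496081) <= 1000000 * log_weight lower_table.
Proof. by apply: (log_weight_lowP ln_tableP); vm_cast_no_check (erefl (Some (10126496081)%Z)). Qed.

Lemma upper_log_weight : IZR (-9893196900) <= 1000000 * log_weight upper_table.
Proof. by apply: (log_weight_lowP ln_tableP); vm_cast_no_check (erefl (Some (-9893196900)%Z)). Qed.
Arguments log_weight : simpl never.

(** * Explicit bounds for [psi] *)

Lemma psi_bounds_round0 Y : psi_bounds Y (92127 / 100000) (125465 / 100000) 180.
Proof.
have l := chebyshev_log_weight; have u := chebyshev_opp_log_weight.
have el : err_weight chebyshev_table = 152%Z by [].
have eu : err_weight chebyshev_table_opp = 152%Z by [].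
(* Up to rounding, the slopes are Chebyshev's constant [0.9212..] and, by way of
   [psi y - psi (y / 6)], this constant plus [2 / 6], with the slope [2] of the base bound. *)
apply: (psi_bounds_step _ _ (@psi_bounds_base Y) chebyshev_dominated chebyshev_opp_dominated (wu := 30));
  rewrite ?el ?eu ?/cost /=; try lra; by [].
Qed.

Lemma psi_bounds_round1 Y : psi_bounds Y (95852 / 100000) (104097 / 100000) 3660.
Proof.
have l := lower_log_weight; have u := upper_log_weight.
have el : err_weight lower_table = 381289%Z by vm_compute.
have eu : err_weight upper_table = 369411%Z by vm_compute.
apply: (psi_bounds_step _ _ (@psi_bounds_round0 Y) lower_dominated upper_dominated (wu := 9981));
  rewrite ?el ?eu ?/cost /=; try lra; by [].
Qed.

(** After the first round [15 A] is still below [14 B]; the second round reverses this. Each round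
    multiplies the constant [C] by about 17, mainly through the step at 8000. *)
Lemma psi_bounds_round2 Y : psi_bounds Y (96775 / 100000) (103131 / 100000) 63690.
Proof.
have l := lower_log_weight; have u := upper_log_weight.
have el : err_weight lower_table = 381289%Z by vm_compute.
have eu : err_weight upper_table = 369411%Z by vm_compute.
apply: (psi_bounds_step _ _ (@psi_bounds_round1 Y) lower_dominated upper_dominated (wu := 9981));
  rewrite ?el ?eu ?/cost /=; try lra; by [].
Qed.

(** * Primes from the bounds for [psi] *)

Lemma rsum_unique (A : eqType) (s : seq A) (P : pred A) : uniq s ->
  {in s &, forall x y, P x -> P y -> x = y} -> rsum s (fun x => INR (P x)) <= 1.
Proof.
elim: s => [|x s IH] /=; first by lra.
move=> /andP[xs us] eqP; case Px: (P x); last first.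
  rewrite Rplus_0_l; apply: IH => // y z ys zs; apply: eqP; rewrite inE ?ys ?zs orbT //.
rewrite (@eq_rsum_in _ s _ (fun=> 0)) ?rsum0; first by rewrite /=; lra.
move=> y ys; case Py: (P y) => //; case/negP: xs.
by rewrite (eqP x y _ _ Px Py) // inE ?eqxx // ys orbT.
Qed.

(* Each prime [p] has at most one power in [(14n, 15n]]; if that power is not [p]
   itself then [p <= s]. *)
Lemma psi_gap_le n s : (0 < n)%N -> (15 * n < s.+1 * s.+1)%N ->
  (forall p, prime p -> (14 * n < p < 15 * n)%N -> False) ->
  psi (15 * n) (15 * n) - psi (15 * n) (14 * n) <= psi (15 * n) s.
Proof.
move=> n0 sn noprime; set Y := (15 * n)%N.
suff : psum Y (fun k => INR (14 * n < k <= Y)%N) <= psi Y s.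
  suff -> : psi Y Y = psi Y (14 * n) + psum Y (fun k => INR (14 * n < k <= Y)%N) by lra.
  rewrite -psumD; apply: eq_psum => k _.
  have [le|lt] := leqP k (14 * n); last by rewrite /=; lra.
  by rewrite (leq_trans le) ?leq_mul2r ?orbT //=; lra.
apply: rsum_le => p; case: ifP => [pp|_]; last by lra.
apply: Rmult_le_compat_l; first exact: ln_INR_ge0.
have Y0 : (0 < Y)%N by rewrite muln_gt0.
have [ex|nex] := boolP (has (fun i => (14 * n < p ^ i <= Y)%N) (iota 1 Y)); last first.
  rewrite (@eq_rsum_in _ (iota 1 Y) _ (fun=> 0)) => [|i si].
    by apply: rsum_le => i; exact: pos_INR.
  by rewrite (negbTE (hasPn nex i si)).
apply: (Rle_trans _ 1).
  apply: (@rsum_unique _ _ (fun i => (14 * n < p ^ i <= Y)%N)); first exact: iota_uniq.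
  move=> i j _ _ /andP[li ui] /andP[lj uj].
  (* Distinct powers of [p] differ by a factor of at least [2 > 15 / 14]. *)
  have lt a b : (14 * n < p ^ a)%N -> (p ^ b <= Y)%N -> (b <= a)%N.
    move=> la ub; rewrite leqNgt; apply/negP => ab.
    have : (p * p ^ a <= Y)%N by rewrite -expnS (leq_trans _ ub) // leq_exp2l // prime_gt1.
    have : (2 * (14 * n) < p * p ^ a)%N.
      by apply: (@leq_trans (2 * p ^ a)); rewrite ?ltn_mul2l // leq_mul2r prime_gt1 ?orbT.
    move=> h1 /(leq_trans h1); rewrite /Y mulnA ltn_mul2r andbC; by [].
  by apply/eqP; rewrite eqn_leq (lt j i) // (lt i j).
case/hasP: ex => -[|[|i]]; rewrite ?mem_iota // => _ /andP[li ui].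
  case: (noprime p pp); rewrite expn1 in li ui; rewrite li ltn_neqAle ui andbT.
  (* The endpoint [15 n] is a proper multiple of 3, hence not prime. *)
  apply/eqP => pY; move: pp; rewrite pY; apply/negP/primePn; right.
  exists 3%N; last by rewrite /Y dvdn_mulr.
  by rewrite (leq_trans (_ : 3 < 15 * 1)%N) // leq_mul2l n0.
have ps : (p <= s)%N.
  rewrite -ltnS ltnNge; apply/negP => sp.
  have : (p ^ 2 <= p ^ i.+2)%N by rewrite leq_exp2l // prime_gt1.
  move=> /leq_trans/(_ ui); rewrite leqNgt => /negP; apply.
  by apply: leq_trans sn _; rewrite -mulnn leq_mul.
have -> : Y = Y.-1.+1 by rewrite prednK.
rewrite /= expn1 ps /=.
have : 0 <= rsum (iota 2 Y.-1) (fun i => INR (p ^ i <= s)%N).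
  by rewrite -(rsum0 (iota 2 Y.-1)); apply: rsum_le => k; exact: pos_INR.
lra.
Qed.

Lemma prime_between_large n : (1800000 <= Z.of_nat n)%Z ->
  exists2 p, prime p & (14 * n < p < 15 * n)%N.
Proof.
move=> nbig.
have [ex|nex] := boolP (has (fun p => prime p && (14 * n < p)%N) (iota 0 (15 * n))).
  by case/hasP: ex => p; rewrite mem_iota /= => pn /andP[pp lp]; exists p; rewrite // lp.
exfalso.
pose s := Nat.sqrt (15 * n).
have [s1 s2] := Nat.sqrt_spec (15 * n) (Nat.le_0_l _); rewrite -/s in s1 s2.
have gap : psi (15 * n) (15 * n) - psi (15 * n) (14 * n) <= psi (15 * n) s.
  apply: psi_gap_le; [by apply/ltP; lia | exact/ltP |] => p pp /andP[lp up].
  by move: (hasPn nex p); rewrite mem_iota up pp lp => /(_ isT).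
have ln14 : (14 * n <= 15 * n)%N by rewrite leq_mul2r orbT.
have ls : (s <= 15 * n)%N by apply/leP; exact: Nat.sqrt_le_lin.
have [l _] := @psi_bounds_round2 (15 * n)%N _ (leqnn _).
have [_ u] := @psi_bounds_round2 (15 * n)%N _ ln14.
have [_ v] := @psi_bounds_base (15 * n)%N _ ls.
have N : 1800000 <= INR n by rewrite INR_IZR_INZ; apply: IZR_le.
have S2 : INR s * INR s <= 15 * INR n.
  have := le_INR _ _ s1; rewrite !mult_INR /=; lra.
have S0 := pos_INR s.
(* A tangent to the square root at [5200^2], close to [15 * 1800000]. The gap [15 A - 14 B] is about
   [0.0779], and from [n = 1800000] on it outweighs [2 C] and [2 s + 100]. *)
have : INR s <= 15 * INR n / 10400 + 2600.
  by have := Rle_0_sqr (INR s - 5200); rewrite /Rsqr; lra.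
move: l u v; rewrite !mult_INR (INR_IZR_INZ 14) (INR_IZR_INZ 15) /=; lra.
Qed.

Lemma prime_of_nat p : prime.prime p -> Znumtheory.prime (Z.of_nat p).
Proof.
move=> /primeP[p1 pdvd]; apply/Znumtheory.prime_alt; split; first by move/ltP: p1; lia.
move=> n n1p [m pmn].
have : (Z.to_nat n %| p)%N by apply/dvdnP; exists (Z.to_nat m); rewrite -[muln _ _]/(Nat.mul _ _); nia.
by move=> /pdvd /orP[] /eqP; lia.
Qed.

Lemma prime_between n : (1800000 <= n)%Z ->
  exists p, Znumtheory.prime p /\ (14 * n < p < 15 * n)%Z.
Proof.
move=> nbig; have [|p pp /andP[/ltP lp /ltP up]] := @prime_between_large (Z.to_nat n).
  by rewrite Z2Nat.id; lia.
rewrite -[muln _ _]/(Nat.mul _ _) in lp; rewrite -[muln _ _]/(Nat.mul _ _) in up.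
by exists (Z.of_nat p); split; [exact: prime_of_nat | lia].
Qed.

End Chebyshev.

(** * The theorem *)

Lemma prime_14_15 n : 2 <= n -> exists p, prime p /\ 14 * n < p < 15 * n.
Proof.
  intros Hn. destruct (Z_lt_le_dec n 200) as [small|]; [|destruct (Z_lt_le_dec n 1800000)].
  - assert (H := all_spec _ _ small_14_15 n ltac:(apply in_zrange; lia)). cbv beta in H.
    destruct (Z.leb_spec n 1); [lia|]. now apply prime_in_ok.
  - apply (prime_chain_ok 2797 chain n ltac:(lia) chain_check); [lia|].
    change (last chain 0) with 25825663. lia.
  - now apply Chebyshev.prime_between.
Qed.

Lemma prime_in_multiples k n : In k [1; 2; 3; 5; 9; 14] -> 1 < n ->
  exists p, prime p /\ k * n < p < (k + 1) * n.
Proof.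
  intros Hk Hn. destruct (Z.eq_dec k 14) as [->|ne]; [now apply prime_14_15; lia|].
  assert (Hk' : In k [1; 2; 3; 5; 9]) by (simpl in *; intuition lia).
  assert (k9 : 1 <= k <= 9) by (simpl in *; intuition lia).
  (* With [m = k * n / 14 + 1] one has [k n < 14 m], and [15 m <= (k + 1) n] follows from
     [n (14 - k) >= 210], which holds for [k <= 9] and [n >= 42]. *)
  destruct (Z_lt_le_dec n 42).
  - assert (H := all_spec _ _ small_multiples k Hk'). cbv beta in H.
    assert (H' := all_spec _ _ H n ltac:(apply in_zrange; lia)). cbv beta in H'.
    destruct (Z.leb_spec n 1); [lia|]. now apply prime_in_ok.
  - assert (E := Z.div_mod (k * n) 14 ltac:(lia)).
    assert (M := Z.mod_pos_bound (k * n) 14 ltac:(lia)).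
    destruct (prime_14_15 (k * n / 14 + 1)) as [p [Hp Hb]]; [nia|].
    exists p. split; auto. nia.
Qed.

Theorem theorem1 (k : Z) (hk : 1 <= k <= 50000000) :
  (forall n : Z, 1 < n -> exists p : Z, prime p /\ k * n < p < (k + 1) * n)
  <-> In k [1; 2; 3; 5; 9; 14].
Proof.
  split; [|intros Hk n; now apply prime_in_multiples].
  intros H. destruct (in_dec Z.eq_dec k [1; 2; 3; 5; 9; 14]) as [|Hk]; auto.
  destruct (prime_free_multiple_exists k hk Hk) as [n [n1 Hn]].
  destruct (H n n1) as [p [Hp Hb]]. destruct (Hn p Hp Hb).
Qed.
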